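(* Let $n\ge2$ and $r\ge0$ be integers, and let $\Delta_{n-1,n}$ be an aligned $\Delta_{n-1,n}$ split of an $n$-simplex in $\mathbb{R}^n$. Then $$\operatorname{mos} S^r(\Delta_{n-1,n})=\rho_{n-1,r},\qquad\text{where } \rho_{n-1,r}=r+(n-2)\left\lfloor\frac{r+1}{2}\right\rfloor.$$
   Context: The split $\Delta_{n-1,n}$: let $T$ be an $n$-simplex in $\mathbb{R}^n$ and $v$ a point in the interior of $T$. For each $(n-1)$-face $F$ of $T$ choose a point $w_F$ in the relative interior of $F$, split $F$ into $n$ simplices of dimension $n-1$ by connecting $w_F$ to the $(n-2)$-faces of $F$, and connect each of these to $v$ (taking convex hulls). The resulting $n(n+1)$ $n$-simplices form the cell $\Delta_{n-1,n}$ around $v$. The split is called aligned if, for every $(n-1)$-face $F$ of $T$, the splitting point $w_F$ is the unique point of $F$ that is collinear with $v$ and the vertex of $T$ opposite $F$. Let $\Delta_v$ be a cell around $v$ (a set of $n$-simplices of a simplicial mesh, all having $v$ as a vertex), here $\Delta_v=\Delta_{n-1,n}$. A spline on $\Delta_v$ is a family $\sigma=\{(U_T,f_T): T\in\Delta_v\}$ with, for each $T$, $U_T\subset\mathbb{R}^n$ open, $T\subset U_T$ and $f_T\in C^\infty(U_T)$ real-valued; $S(\Delta_v)$ is the set of all such splines. For a multi-index $\alpha$, $D^\alpha$ is the corresponding partial derivative, of order $|\alpha|$. For an integer $r\ge0$, $S^r(\Delta_v)$ is the set of $\sigma\in S(\Delta_v)$ such that $D^\alpha f_{T_1}|_F=D^\alpha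 f_{T_2}|_F$ for all $|\alpha|\le r$ and all $T_1,T_2\in\Delta_v$ such that $F=T_1\cap T_2$ is an $(n-1)$-face. For an integer $\rho\ge0$, $C^\rho(\Delta_v)$ is the set of $\sigma\in S(\Delta_v)$ such that $D^\alpha f_{T_1}(v)=D^\alpha f_{T_2}(v)$ for all $|\alpha|\le\rho$ and all $T_1,T_2\in\Delta_v$. The maximal order of supersmoothness is $\operatorname{mos} S^r(\Delta_v)=\max\{\rho\ge r: S^r(\Delta_v)\subset C^\rho(\Delta_v)\}$ ($\rho$ an integer). *)

(* Defs.v *)
(* R^n is 'rV[R]_n for R : realType. *)
From HB Require Import structures.
From mathcomp Require Import all_boot all_order all_algebra.
From mathcomp Require Import all_classical all_reals all_analysis.

Set Implicit Arguments.
Unset Strict Implicit.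
Unset Printing Implicit Defensive.

Import Order.TTheory GRing.Theory Num.Theory.
Import numFieldNormedType.Exports.

Local Open Scope classical_set_scope.
Local Open Scope ring_scope.

Section Geometry.
Context {R : realType} {n : nat}.
Implicit Types (x y z : 'rV[R]_n) (A F T : set 'rV[R]_n).

Definition convex_hull A : set 'rV[R]_n :=
  smallest (@convex_set R 'rV[R]_n) A.

Definition affine_set A :=
  forall x y (t : R), A x -> A y -> A ((1 - t) *: x + t *: y).

Definition affine_hull A : set 'rV[R]_n := smallest affine_set A.

(* The interior of A in the topology induced on its affine hull. *)
Definition relative_interior A : set 'rV[R]_n :=
  [set x | A x /\ exists2 U, nbhs x U & U `&` affine_hull A `<=` A].

Definition affinely_independent m (p : 'I_m -> 'rV[R]_n) :=
  forall c : 'I_m -> R,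
    \sum_i c i = 0 -> \sum_i c i *: p i = 0 -> forall i, c i = 0.

(* A degenerate "line" (d = 0) only makes coinciding points collinear. *)
Definition collinear x y z :=
  exists p d : 'rV[R]_n, [set x; y; z] `<=` range (fun t : R => p + t *: d).

(* F is a k-dimensional face of the simplex T. *)
Definition is_face (k : nat) F T :=
  exists m (p : 'I_m.+1 -> 'rV[R]_n) (s : 'I_k.+1 -> 'I_m.+1),
    [/\ affinely_independent p, injective s,
        T = convex_hull (range p) & F = convex_hull (range (p \o s))].

Definition join x A : set 'rV[R]_n := convex_hull (x |` A).

End Geometry.

Section Derivatives.
Context {R : realType} {n : nat}.
Implicit Types (f : 'rV[R]_n -> R) (U : set 'rV[R]_n).

Definition partial (i : 'I_n) f : 'rV[R]_n -> R := 'D_(delta_mx 0 i) f.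

Definition multi_index := {ffun 'I_n -> nat}.

Definition morder (alpha : multi_index) : nat := (\sum_i alpha i)%N.

(* The coordinates are differentiated in a fixed order, which is immaterial
   for smooth functions. *)
Definition Dmulti (alpha : multi_index) f : 'rV[R]_n -> R :=
  foldr (fun i g => iter (alpha i) (partial i) g) f (enum 'I_n).

(* For U open: all iterated partial derivatives of f of order at most k exist
   and are continuous on U. *)
Fixpoint Ck (k : nat) U f : Prop :=
  (forall x, U x -> {for x, continuous f}) /\
  if k is k'.+1 then
    forall i, (forall x, U x -> derivable f x (delta_mx 0 i)) /\
              Ck k' U (partial i f)
  else True.

Definition Cinfty U f := forall k, Ck k U f.

End Derivatives.

Section Splines.
Context {R : realType} {n : nat}.

(* A real function given on an open set dom, extended to a total function; its
   values and derivatives outside dom are irrelevant. *)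
Record local_fun := LocalFun {
  dom : set 'rV[R]_n;
  fct :> 'rV[R]_n -> R
}.

(* A family (U_T, f_T) indexed by n-simplices, seen as subsets of R^n; only its
   values at the simplices of the cell under consideration matter. *)
Definition spline_family := set 'rV[R]_n -> local_fun.

Implicit Types (Delta : set (set 'rV[R]_n)) (sigma : spline_family).

Definition splines Delta : set spline_family :=
  [set sigma | forall T, Delta T ->
     [/\ open (dom (sigma T)), T `<=` dom (sigma T) &
         Cinfty (dom (sigma T)) (sigma T)]].

Definition smooth_splines (r : nat) Delta : set spline_family :=
  [set sigma | splines Delta sigma /\
     forall T1 T2, Delta T1 -> Delta T2 ->
       is_face n.-1 (T1 `&` T2) T1 -> is_face n.-1 (T1 `&` T2) T2 ->
       forall alpha : multi_index, (morder alpha <= r)%N ->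
       forall x, (T1 `&` T2) x ->
         Dmulti alpha (sigma T1) x = Dmulti alpha (sigma T2) x].

Definition supersmooth_splines (rho : nat) Delta (v : 'rV[R]_n) :
    set spline_family :=
  [set sigma | splines Delta sigma /\
     forall T1 T2, Delta T1 -> Delta T2 ->
       forall alpha : multi_index, (morder alpha <= rho)%N ->
         Dmulti alpha (sigma T1) v = Dmulti alpha (sigma T2) v].

(* The maximum is stated as a relation, so that its existence is part of the
   claim. *)
Definition is_mos (r : nat) Delta (v : 'rV[R]_n) (m : nat) :=
  let orders :=
    [set rho | (r <= rho)%N /\
       smooth_splines r Delta `<=` supersmooth_splines rho Delta v] in
  orders m /\ ubound orders m.

End Splines.

Section Split.
Context {R : realType} {n : nat}.
(* The vertices of the n-simplex, the interior point, and the splitting points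
   of the (n-1)-faces, where w i belongs to the face opposite to a i. *)
Variables (a : 'I_n.+1 -> 'rV[R]_n) (v : 'rV[R]_n) (w : 'I_n.+1 -> 'rV[R]_n).

Definition facet (i : 'I_n.+1) : set 'rV[R]_n :=
  convex_hull (a @` (~` [set i])).

Definition is_split :=
  [/\ affinely_independent a, interior (convex_hull (range a)) v &
      forall i, relative_interior (facet i) (w i)].

(* The (n-2)-faces of facet i are spanned by the a k with k <> i, j, for some
   j <> i. *)
Definition split_cell : set (set 'rV[R]_n) :=
  [set T | exists i j, i != j /\
     T = join v (join (w i) (convex_hull (a @` (~` [set i; j]))))].

Definition aligned :=
  forall i, facet i `&` [set y | collinear y v (a i)] = [set w i].

End Split.

(* Main.v *)
Require Import Defs.
From mathcomp Require Import all_boot all_order all_algebra.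
From mathcomp Require Import all_classical all_reals all_analysis.
From mathcomp Require mpoly.
From mathcomp Require Import ring lra zify.
Import -(notations) mpoly.
Import Order.TTheory GRing.Theory Num.Theory.
Import numFieldNormedType.Exports.

(** Put the origin at [v] and let [lam i] be the barycentric coordinates of [v].
    The vectors [b i = lam i *: (a i - v)] sum to zero and span the space, so a
    point is [\sum_i xi i *: b i] for some [xi], unique up to a constant.
    Alignment makes [w i - v] a negative multiple of [b i].
    Hence the cone of the cell [(i, j)] is given by
    [xi i <= xi j <= xi k] for all other [k]: the cells are cut out by the walls
    [xi p = xi q] of the braid arrangement, and adjacent cells are
    [(i, j), (i, j')] across [xi j = xi j'] and [(i, j), (j, i)] across
    [xi i = xi j].

    Upper bound.  Let [P i j] be the Taylor polynomial at [v], of degree at most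
    [rho = r + (n - 2) * k] with [k = floor ((r + 1) / 2)], of the piece on the
    cell [(i, j)].  Smoothness across a common face makes the difference of two
    adjacent Taylor polynomials vanish to order [r] on the wall
    ([vanish_on_wall]).  The algebraic core is [alfeld_rigidity]: if polynomials
    [p i], [i] in a set [I] of indices, have degree at most
    [r + (#|I| - 2) * k] and [p i - p j] vanishes to order [r] on
    [xi i = xi j], then they are all equal.  It is proved by induction on [I]:
    after [k] derivatives along one edge [b i0] the other polynomials agree by
    induction, so the [k]-th derivative [G] of [p i0 - p i] does not depend on
    [i]; on a line directed by [b i0] it has #|I| - 1 roots of multiplicity
    [r + 1 - k], too many for its degree.  So [G = 0], and [p i0 - p i] has
    degree less than [k] on the line and a root of multiplicity [r + 1]: it is
    zero.  For fixed [i] this gives that [P i j] is the same for all [j]; applied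
    once more to these common values, omitting one index at a time, it gives that
    all the [P i j] are equal.

    Lower bound.  Take coordinates [y] in which [xi ord0 = 0].  On the region
    where [y j] is the smallest coordinate let the spline be the polynomial
    [F j], the integral from [0] to [y j] of
    [\prod_l (t - y l) ^+ kappa l].  Then [F j - F l] is divisible by
    [(y j - y l) ^+ (kappa j + kappa l + 1)] ([piece_diff]), so the spline is
    smooth of order [r] when [kappa] takes the value [k] everywhere except one
    value [r - k].  On the line directed by an edge, [F j - F l] is a nonzero
    multiple of [t ^+ (rho + 1)] ([piece_diff_line]), so derivatives of order
    [rho + 1] at [v] differ. *)

Set Implicit Arguments.
Unset Strict Implicit.
Unset Printing Implicit Defensive.

Local Open Scope ring_scope.

Local Notation msize p := (@mmeasure _ _ (@mdeg _) p).

(** * Univariate polynomials *)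

Section PolyAux.
Context {R : realFieldType}.
Implicit Types p q : {poly R}.

Lemma poly_eventually0 p (M : R) : (forall t, M < t -> p.[t] = 0) -> p = 0.
Proof.
move=> h; apply: (@roots_geq_poly_eq0 _ p [seq M + i.+1%:R | i <- iota 0 (size p)]).
- apply/allP => _ /mapP [i _ ->]; apply/rootP/h.
  by rewrite ltrDl ltr0n.
- rewrite map_inj_uniq ?iota_uniq // => i j /addrI /eqP.
  by rewrite eqr_nat => /eqP [].
- by rewrite size_map size_iota.
Qed.

(** Taylor expansion at [t], in characteristic zero: one factor is split off at a
    time, and [t] annihilates one derivative less of the quotient. *)
Lemma dvdp_exp_XsubC p t k :
  (forall a, (a < k)%N -> (p^`(a)).[t] = 0) -> ('X - t%:P) ^+ k %| p.
Proof.
elim: k p => [|k IH] p h; first by rewrite expr0 dvd1p.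
have /factor_theorem [q Dp] : root p t by apply/rootP; apply: (h 0%N).
suff: ('X - t%:P) ^+ k %| q by rewrite Dp exprSr => ?; apply: dvdp_mul.
apply: IH => a ak.
have := h a.+1 ak.
rewrite Dp.
suff -> : forall b s, ((s * ('X - t%:P))^`(b.+1)).[t] = s^`(b).[t] *+ b.+1.
  by move/eqP; rewrite -mulr_natr mulf_eq0 pnatr_eq0 orbF => /eqP.
move=> b s.
have -> : (s * ('X - t%:P))^`(b.+1) = s^`(b.+1) * ('X - t%:P) + s^`(b) *+ b.+1.
  elim: b => [|b IHb].
    by rewrite derivn1 derivM derivXsubC mulr1 derivn0 mulr1n.
  rewrite [LHS]derivnS IHb derivD derivM derivXsubC mulr1 derivMn -!derivnS.
  by rewrite -addrA -mulrS.
by rewrite hornerD hornerM hornerXsubC subrr mulr0 add0r hornerMn.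
Qed.

Lemma dvdp_prod_exp_XsubC (T : eqType) (s : seq T) (t : T -> R) k p :
  uniq (map t s) -> (forall i, i \in s -> ('X - (t i)%:P) ^+ k %| p) ->
  \prod_(i <- s) ('X - (t i)%:P) ^+ k %| p.
Proof.
elim: s => [|i s IH] /= us h; first by rewrite big_nil dvd1p.
case/andP: us => nis us.
rewrite big_cons Gauss_dvdp.
  rewrite h ?mem_head // IH // => j js; apply: h; exact: mem_behead.
rewrite big_seq; elim/big_ind: _.
- exact: coprimep1.
- by move=> x y hx hy; rewrite coprimepMr hx hy.
move=> j js; apply: coprimep_expl; apply: coprimep_expr.
rewrite coprimep_XsubC root_XsubC; apply: contra nis => /eqP <-.
exact: map_f.
Qed.

Lemma size_prod_exp_XsubC (T : eqType) (s : seq T) (t : T -> R) k :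
  size (\prod_(i <- s) ('X - (t i)%:P) ^+ k) = (size s * k).+1.
Proof.
rewrite (eq_bigr (fun i => \prod_(j < k) ('X - (t i)%:P))); last first.
  by move=> i _; rewrite prodr_const card_ord.
elim: s => [|i s IH]; first by rewrite big_nil size_poly1.
rewrite big_cons prodr_const card_ord size_monicM ?monic_exp ?monicXsubC //.
  by rewrite IH size_exp_XsubC /= mulSn addnS.
rewrite -size_poly_eq0 IH //.
Qed.

(** Characteristic zero: the falling factorials do not vanish. *)
Lemma size_derivn_small p k : p^`(k) = 0 -> (size p <= k)%N.
Proof.
move=> h; apply/leq_sizeP => j kj.
have /eqP := congr1 (fun q : {poly R} => q`_(j - k)) h.
rewrite coef_derivn coef0 subnKC // -mulr_natr mulf_eq0 pnatr_eq0.
by rewrite -leqn0 leqNgt ffact_gt0 kj /= orbF => /eqP.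
Qed.

End PolyAux.

(** * Directional derivatives of polynomials in several variables *)

Section Poly.
Context {R : realFieldType} {n : nat}.
Implicit Types (P Q : mpoly n R) (x u : 'rV[R]_n) (w : seq 'I_n).

Definition peval P x : R := meval (fun i => x 0 i) P.

(** The restriction of [P] to a parametrized line turns questions on polynomials in
    several variables into counting roots of univariate ones. *)
Definition pline P x u : {poly R} :=
  mmap polyC (fun i => (x 0 i)%:P + u 0 i *: 'X) P.

Definition pdir u P : mpoly n R := \sum_i u 0 i *: mderiv i P.

Lemma horner_pline P x u t : (pline P x u).[t] = peval P (x + t *: u).
Proof.
rewrite /pline /peval /meval /mmap horner_sum.
apply: eq_bigr => m _; rewrite hornerM hornerC; congr (_ * _).
rewrite /mmap1 horner_prod; apply: eq_bigr => i _.
by rewrite !hornerE !mxE mulrC.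
Qed.

Lemma pdirD u P Q : pdir u (P + Q) = pdir u P + pdir u Q.
Proof.
rewrite /pdir -big_split; apply: eq_bigr => i _.
by rewrite raddfD scalerDr.
Qed.

Lemma pdirZ u c P : pdir u (c *: P) = c *: pdir u P.
Proof.
rewrite /pdir scaler_sumr; apply: eq_bigr => i _.
by rewrite mderivZ !scalerA mulrC.
Qed.

Lemma pdirB u P Q : pdir u (P - Q) = pdir u P - pdir u Q.
Proof. by rewrite pdirD -scaleN1r pdirZ scaleN1r. Qed.

Lemma pdirM u P Q : pdir u (P * Q) = pdir u P * Q + P * pdir u Q.
Proof.
rewrite /pdir mulr_suml mulr_sumr -big_split; apply: eq_bigr => i _.
by rewrite mderivM scalerDr scalerAl scalerAr.
Qed.

Lemma plineD P Q x u : pline (P + Q) x u = pline P x u + pline Q x u.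
Proof. exact: mmapD. Qed.

Lemma plineB P Q x u : pline (P - Q) x u = pline P x u - pline Q x u.
Proof. exact: mmapB. Qed.

Lemma plineZ c P x u : pline (c *: P) x u = c *: pline P x u.
Proof. by rewrite /pline mmapZ mul_polyC. Qed.

Lemma plineM P Q x u : pline (P * Q) x u = pline P x u * pline Q x u.
Proof. by rewrite /pline rmorphM. Qed.

Lemma pdir_var u i : pdir u (mpolyX R (mnm1 i)) = u 0 i *: 1.
Proof.
rewrite /pdir (bigD1 i) //= big1 ?addr0 => [|j ji].
  rewrite mderivX mnm1E eqxx scale1r; congr (_ *: _).
  by rewrite -[X in mnm_sub X _]add0m addmK mpolyX0.
by rewrite mderivX mnm1E eq_sym (negbTE ji) scale0r scaler0.
Qed.

Lemma pdir_delta i P : pdir (delta_mx 0 i) P = mderiv i P.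
Proof.
rewrite /pdir (bigD1 i) //= mxE !eqxx scale1r big1 ?addr0 // => j ji.
by rewrite mxE eqxx (negbTE ji) scale0r.
Qed.

(** Both sides are derivations along [P |-> pline P x u], so it suffices to compare
    them on the variables. *)
Lemma deriv_pline P x u : (pline P x u)^`() = pline (pdir u P) x u.
Proof.
pose good Q := (pline Q x u)^`() = pline (pdir u Q) x u.
have goodM P1 P2 : good P1 -> good P2 -> good (P1 * P2).
  by rewrite /good => h1 h2; rewrite plineM pdirM plineD !plineM derivM h1 h2.
have good1 : good 1.
  rewrite /good; have -> : pdir u 1 = 0.
    by rewrite /pdir big1 // => i _; rewrite mderivC scaler0.
  by rewrite /pline mmap0 mmapC derivC.
have goodX i : good (mpolyX R (mnm1 i)).
  rewrite /good pdir_var plineZ /pline mmapX mmap1U mmapC.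
  by rewrite derivD derivC add0r derivZ derivX -polyC1.
rewrite -/(good P); elim/mpolyind: P => [|c m P _ _ IH].
  by rewrite /good -(scale0r 1) pdirZ !scale0r /pline mmap0 deriv0.
rewrite /good pdirD !plineD derivD IH; congr (_ + _).
rewrite pdirZ !plineZ derivZ; congr (_ *: _).
rewrite -/(good _) mpolyXE_id; apply: big_ind => // i _.
by elim: (m i) => [|k IHk]; rewrite ?expr0 // exprS; apply: goodM.
Qed.

Lemma derivn_pline P x u k : (pline P x u)^`(k) = pline (iter k (pdir u) P) x u.
Proof. by elim: k => [|k IH]; rewrite ?derivn0 // derivnS IH deriv_pline. Qed.

Lemma size_pline P x u : (size (pline P x u) <= msize P)%N.
Proof.
rewrite /pline /mmap big_seq; apply: (leq_trans (size_sum _ _ _)).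
apply/bigmax_leqP_seq => m mP _.
apply: leq_trans (msize_mdeg_lt mP).
have [->|c0] := eqVneq (mcoeff m P) 0; first by rewrite mul0r size_poly0.
rewrite mul_polyC size_scale //.
rewrite /mmap1 mdegE.
elim: (index_enum _) => [|i s IH]; first by rewrite !big_nil size_poly1.
rewrite !big_cons; apply: (leq_trans (size_polyMleq _ _)).
suff h : (size (((x 0 i)%:P + u 0 i *: 'X) ^+ m i : {poly R})%R <= (m i).+1)%N.
  by move: (size _) (size _) h IH => *; lia.
apply: (leq_trans (size_poly_exp_leq _ _)); rewrite ltnS.
rewrite -{2}[m i]mul1n leq_mul2r; apply/orP; right.
suff : (size ((x 0 i)%:P + u 0 i *: 'X : {poly R})%R <= 2)%N by case: size.
apply: (leq_trans (size_polyD _ _)); rewrite geq_max.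
rewrite (leq_trans (size_polyC_leq1 _)) //=.
by apply: (leq_trans (size_scale_leq _ _)); rewrite size_polyX.
Qed.

Lemma msize_mderiv i P :
  (msize (mderiv i P) <= (msize P).-1)%N.
Proof.
rewrite msizeE; apply/bigmax_leqP_seq => m mP _.
rewrite mcoeff_msupp mcoeff_deriv in mP.
have /msize_mdeg_lt : mnm_add m (mnm1 i) \in msupp P.
  by rewrite mcoeff_msupp; apply: contra mP => /eqP ->; rewrite mul0rn.
by rewrite mdegD mdeg1; lia.
Qed.

Lemma msize_pdir u P :
  (msize (pdir u P) <= (msize P).-1)%N.
Proof.
rewrite /pdir; apply: leq_trans (msize_sum _ _ _) _.
apply/bigmax_leqP => i _.
exact: (leq_trans (msizeZ_le _ _)) (msize_mderiv _ _).
Qed.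

Lemma msize_iter_pdir u P k :
  (msize (iter k (pdir u) P) <= (msize P) - k)%N.
Proof.
elim: k => [|k IH]; first by rewrite subn0.
by apply: leq_trans (msize_pdir _ _) _; rewrite subnS -!subn1 leq_sub2r.
Qed.

(** Iterated partial derivatives are indexed by words rather than by multi-indices:
    words of bounded length are stable under adding a derivative at either end. *)
Definition pderivs P w : mpoly n R := foldr (@mderiv n R) P w.

Lemma pderivs_sum P w : forall u,
  pderivs (pdir u P) w = \sum_i u 0 i *: pderivs P (rcons w i).
Proof.
move=> u; elim: w => [|j w IH] //=.
rewrite IH raddf_sum; apply: eq_bigr => i _ /=.
by rewrite mderivZ.
Qed.

Lemma pderivs_pdir P w u : pderivs (pdir u P) w = pdir u (pderivs P w).
Proof.
rewrite pderivs_sum; apply: eq_bigr => i _; congr (_ *: _).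
rewrite /pderivs -[mderiv i _]/(foldr (@mderiv n R) P (i :: w)).
by apply: mderiv_perm; rewrite perm_rcons.
Qed.

Lemma pderivsB P Q w : pderivs (P - Q) w = pderivs P w - pderivs Q w.
Proof. by elim: w => //= i w ->; rewrite raddfB. Qed.

Lemma pderivs_cat P w1 w2 : pderivs P (w1 ++ w2) = pderivs (pderivs P w2) w1.
Proof. by rewrite /pderivs foldr_cat. Qed.

Lemma pevalB P Q x : peval (P - Q) x = peval P x - peval Q x.
Proof. exact: mevalB. Qed.

Lemma pevalZ c P x : peval (c *: P) x = c * peval P x.
Proof. exact: mevalZ. Qed.

Lemma pevalM P Q x : peval (P * Q) x = peval P x * peval Q x.
Proof. exact: mevalM. Qed.

Lemma peval_sum I (r : seq I) (F : I -> mpoly n R) x :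
  peval (\sum_(i <- r) F i) x = \sum_(i <- r) peval (F i) x.
Proof. by rewrite /peval raddf_sum. Qed.

(** Contact of order [r] with [0] along [H].  When [H] is the hyperplane [l = 0] it
    means that [l ^+ r.+1] divides [Q]; the differential form is the one that
    splines provide and that restricts to lines. *)
Definition vanish (r : nat) (H : 'rV[R]_n -> Prop) Q :=
  forall w, (size w <= r)%N -> forall x, H x -> peval (pderivs Q w) x = 0.

Lemma vanish_pdir r H Q u : vanish r.+1 H Q -> vanish r H (pdir u Q).
Proof.
move=> hv w wr x Hx; rewrite pderivs_sum peval_sum big1 // => i _.
by rewrite pevalZ hv ?mulr0 // size_rcons.
Qed.

Lemma vanish_le r s H Q : (s <= r)%N -> vanish r H Q -> vanish s H Q.
Proof. by move=> sr hv w ws; apply: hv; apply: leq_trans sr. Qed.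

Lemma vanish_iter_pdir k r H Q u :
  vanish (r + k) H Q -> vanish r H (iter k (pdir u) Q).
Proof.
elim: k r => [|k IH] r; first by rewrite addn0.
by rewrite addnS -addSn => h; exact: vanish_pdir (IH _ h).
Qed.

Lemma pline_eq0 Q x u : (forall t, peval Q (x + t *: u) = 0) -> pline Q x u = 0.
Proof. by move=> h; apply: (@poly_eventually0 _ _ 0) => t _; rewrite horner_pline. Qed.

Lemma pdir_eval0 Q x u :
  (forall t, peval Q (x + t *: u) = 0) -> peval (pdir u Q) x = 0.
Proof.
move=> /pline_eq0 /(congr1 deriv); rewrite deriv_pline deriv0.
move=> /(congr1 (fun p => p.[0])).
by rewrite horner_pline scale0r addr0 horner0.
Qed.

(** A derivative tangent to [H] loses no order, in contrast to [vanish_pdir]. *)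
Lemma vanish_pdir_tangent r H Q u : (forall x t, H x -> H (x + t *: u)) ->
  vanish r H Q -> vanish r H (pdir u Q).
Proof.
move=> Hu hv w wr x Hx; rewrite pderivs_pdir; apply: pdir_eval0 => t.
by apply: hv => //; apply: Hu.
Qed.

Lemma vanish_pline r (H : 'rV[R]_n -> Prop) Q x u t : H (x + t *: u) ->
  vanish r H Q -> ('X - t%:P) ^+ r.+1 %| pline Q x u.
Proof.
move=> Hx hv; apply: dvdp_exp_XsubC => a ar.
rewrite derivn_pline horner_pline.
have hva : vanish (0 + a) H Q by exact: (@vanish_le r (0 + a) H Q ar hv).
exact: (@vanish_iter_pdir a 0 H Q u hva [::]).
Qed.

End Poly.

(** * Rigidity of polynomials across the walls of the braid arrangement *)

Section Alfeld.
Context {R : realFieldType} {n N : nat} (b : 'I_N -> 'rV[R]_n).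
Implicit Types (xi eta : 'I_N -> R) (P Q : mpoly n R).

(** The [xi] are redundant coordinates: in the application the [N = n + 1] vectors
    [b l] of an [n]-dimensional space sum to zero. *)
Definition pt xi : 'rV[R]_n := \sum_l xi l *: b l.

Definition wall j k : 'rV[R]_n -> Prop :=
  fun x => exists2 xi, xi j = xi k & x = pt xi.

Lemma ptD xi eta t : pt xi + t *: pt eta = pt (fun l => xi l + t * eta l).
Proof.
rewrite /pt scaler_sumr -big_split; apply: eq_bigr => l _ /=.
by rewrite scalerDl scalerA.
Qed.

Lemma pt_basis i : b i = pt (fun l => (l == i)%:R).
Proof.
rewrite /pt (bigD1 i) //= eqxx scale1r big1 ?addr0 // => l /negbTE ->.
by rewrite scale0r.
Qed.

Lemma wall_tangent i j l x t : l != i -> l != j -> wall i j x ->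
  wall i j (x + t *: b l).
Proof.
move=> li lj [xi xij ->]; rewrite [b l]pt_basis ptD.
eexists; last by [].
by rewrite /= xij eq_sym (negbTE li) eq_sym (negbTE lj).
Qed.

Lemma iter_pdirB k u P Q :
  iter k (pdir u) (P - Q) = iter k (pdir u) P - iter k (pdir u) Q.
Proof. by elim: k => //= k ->; rewrite pdirB. Qed.

Lemma spread_le xi l m : xi l - xi m <= \sum_i `|xi i| *+ 2.
Proof.
have bnd i : `|xi i| *+ 2 <= \sum_i `|xi i| *+ 2.
  by rewrite (bigD1 i) //= lerDl sumr_ge0 // => j _; rewrite mulrn_wge0.
have := bnd l; have := bnd m; rewrite !mulr2n.
have := ler_norm (xi l); have := ler_norm (- xi m); rewrite normrN; lra.
Qed.

Lemma spread_ge0 xi : 0 <= \sum_i `|xi i| *+ 2.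
Proof. by apply: sumr_ge0 => j _; rewrite mulrn_wge0. Qed.

(** Generic points are reached along a fixed direction whose coordinates are
    distinct; this replaces a density argument. *)
Lemma eventually_inj xi : exists M, forall t, M < t ->
  injective (fun l : 'I_N => xi l + t * (l : nat)%:R).
Proof.
exists (\sum_l `|xi l| *+ 2) => t tM l m E.
apply/eqP; apply/negP => lm.
have t0 : 0 < t := le_lt_trans (spread_ge0 xi) tM.
have h1 : `|xi m - xi l| <= \sum_l `|xi l| *+ 2.
  by rewrite ler_norml spread_le andbT lerNl opprB spread_le.
have h2 : t <= `|t * ((l : nat)%:R - (m : nat)%:R)|.
  rewrite normrM gtr0_norm // ler_peMr ?(ltW t0) //.
  have [lm'|lm'] : (l < m)%N \/ (m < l)%N.
    by apply/orP; rewrite -neq_ltn; apply/negP.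
    by rewrite distrC -natrB ?(ltnW lm') // normr_nat ler1n subn_gt0.
  by rewrite -natrB ?(ltnW lm') // normr_nat ler1n subn_gt0.
suff E2 : xi m - xi l = t * ((l : nat)%:R - (m : nat)%:R) by move: h1 h2 tM; rewrite E2; lra.
by move: E => /=; rewrite mulrBr; lra.
Qed.

(** The bound on [d] is sharp; it is the order of supersmoothness of the split of a
    simplex of dimension [size I - 1] at one interior point.  Only the indices in
    [I] are constrained, so that the induction can drop [i0] and keep the ambient
    polynomial ring. *)
Lemma alfeld_rigidity r k (I : seq 'I_N) (p : 'I_N -> mpoly n R) d :
  (k.*2 <= r.+1)%N -> uniq I ->
  (forall i j, i \in I -> j \in I -> i != j -> vanish r (wall i j) (p i - p j)) ->
  (forall i, i \in I -> (msize (p i) <= d.+1)%N) ->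
  (d + k <= r + (size I).-1 * k)%N ->
  forall i j, i \in I -> j \in I ->
  forall xi, peval (p i) (pt xi) = peval (p j) (pt xi).
Proof.
move=> k2; elim: I p d => [//|i0 I IH] p d /= /andP [i0I uI] hv hd hdk.
suff key : forall i, i \in I -> forall xi, peval (p i0 - p i) (pt xi) = 0.
  have key' i xi : i \in i0 :: I -> peval (p i0) (pt xi) = peval (p i) (pt xi).
    rewrite inE => /orP [/eqP -> //|iI]; apply/eqP.
    by rewrite -subr_eq0 -pevalB key.
  by move=> i j iI jI xi; rewrite -!key'.
have neq0 i : i \in I -> i0 != i by apply: contraTneq => <-.
have s0 i : i \in I -> (0 < size I)%N by case: (I).
have kr : (k <= r)%N by lia.
pose b0 := b i0.
pose G i := iter k (pdir b0) (p i0 - p i).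
(* The derivations along b0 are tangent to the walls that avoid i0: the induction
   hypothesis applies to the k-th derivatives. *)
have GG i j xi : i \in I -> j \in I -> pline (G i) (pt xi) b0 = pline (G j) (pt xi) b0.
  move=> iI jI; apply/eqP; rewrite -subr_eq0 -plineB; apply/eqP/pline_eq0 => t.
  rewrite [b0]pt_basis ptD /G !iter_pdirB !pevalB.
  have -> // := IH (fun j => iter k (pdir b0) (p j)) (d - k)%N uI _ _ _ i j iI jI; last 1 first.
  - by have := s0 _ iI; nia.
  - by rewrite subrr.
  - move=> l m lI mI lm; rewrite -iter_pdirB.
    have hlm : vanish r (wall l m) (p l - p m) by apply: hv; rewrite // inE ?lI ?mI orbT.
    elim: (k) => [|k' IHk] //=.
    by apply: vanish_pdir_tangent IHk => x t'; apply: wall_tangent; rewrite neq0.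
  - move=> l lI; apply: leq_trans (msize_iter_pdir _ _ _) _.
    by have := hd l; rewrite inE lI orbT => /(_ isT); lia.
(* For distinct coordinates the line crosses the walls of i0 at distinct points. *)
have distinct i xi : i \in I -> injective xi -> pline (p i0 - p i) (pt xi) b0 = 0.
  move=> iI xiI.
  have on_wall j : wall i0 j (pt xi + (xi j - xi i0) *: b0).
    rewrite [b0]pt_basis ptD; eexists; last by [].
    rewrite /= eqxx; have [->|_] := eqVneq j i0; first by [].
    by rewrite mulr1 mulr0 addr0; lra.
  have hvj j : j \in I -> vanish r (wall i0 j) (p i0 - p j).
    by move=> jI; apply: hv; rewrite ?mem_head ?inE ?jI ?orbT ?neq0.
  have G0 : pline (G i) (pt xi) b0 = 0.
    apply/eqP; apply/negPn/negP => Gn0.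
    have h2 := size_pline (G i) (pt xi) b0.
    have : \prod_(j <- I) ('X - (xi j - xi i0)%:P) ^+ (r - k).+1
        %| pline (G i) (pt xi) b0.
      apply: dvdp_prod_exp_XsubC => [|j jI].
        by rewrite map_inj_uniq // => x y /addIr /xiI.
      rewrite (GG i j) //; apply: vanish_pline (on_wall j) _.
      by apply: vanish_iter_pdir; rewrite subnK //; exact: hvj.
    move=> /(dvdp_leq Gn0); rewrite size_prod_exp_XsubC => h1.
    have h3 := msize_iter_pdir b0 (p i0 - p i) k.
    have h4 : (msize (p i0 - p i) <= d.+1)%N.
      apply: leq_trans (msizeD_le _ _) _; rewrite msizeN geq_max.
      by rewrite !hd ?mem_head // inE iI orbT.
    have := leq_trans h1 (leq_trans h2 (leq_trans h3 (leq_sub2r k h4))).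
    (* (size I) * (r + 1 - k) roots against the degree d - k. *)
    have [c Dr] : exists c, r.+1 = (k + k + c)%N by exists (r.+1 - (k + k))%N; lia.
    have -> : (r - k).+1 = (k + c)%N by lia.
    rewrite mulnDr => h5.
    have h6 : (c <= size I * c)%N by rewrite leq_pmull // (s0 i).
    have {}h5 : (size I * k + size I * c < d.+1 - k)%N := h5.
    by move: hdk; lia.
  (* The degree is below k, and there is a root of multiplicity r + 1 > k. *)
  apply/eqP; apply/negPn/negP => Pn0.
  have h1 := vanish_pline (on_wall i) (hvj i iI).
  have := dvdp_leq Pn0 h1; rewrite size_exp_XsubC.
  move=> /leq_trans /(_ (size_derivn_small (etrans (derivn_pline _ _ _ _) G0))).
  by lia.
move=> i iI xi.
have [M hM] := eventually_inj xi.
have : pline (p i0 - p i) (pt xi) (pt (fun l => (l : nat)%:R)) = 0.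
  apply: (@poly_eventually0 _ _ M) => t tM; rewrite horner_pline ptD.
  have := distinct i _ iI (hM t tM).
  move=> /(congr1 (fun q : {poly R} => q.[0])).
  by rewrite horner_pline scale0r addr0 horner0.
move=> /(congr1 (fun q : {poly R} => q.[0])).
by rewrite horner_pline scale0r addr0 horner0.
Qed.

End Alfeld.

(** * Smooth functions of several variables *)

Local Open Scope classical_set_scope.

Section Calculus.
Context {R : realType} {n : nat}.
Implicit Types (f g : 'rV[R]_n -> R) (U : set 'rV[R]_n) (x y u v : 'rV[R]_n).
Local Notation e_ i := (delta_mx 0 i : 'rV[R]_n).

Lemma is_derive_line f x u s : derivable f (x + s *: u) u ->
  is_derive s (1 : R) (fun t => f (x + t *: u)) ('D_u f (x + s *: u)).
Proof.
move=> fd.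
have E : (fun h : R => h^-1 *: (((fun t => f (x + t *: u)) \o shift s) (h *: 1) - f (x + s *: u)))
  = (fun h : R => h^-1 *: ((f \o shift (x + s *: u)) (h *: u) - f (x + s *: u))).
  apply/funext => h /=; congr (_ *: (f _ - _)).
  by rewrite [h%:A]mulr1 scalerDl addrCA.
by apply: DeriveDef; [rewrite /derivable E | rewrite /derive E].
Qed.

Lemma MVT_line f x u (t : R) : 0 < t ->
  (forall s, 0 <= s <= t -> derivable f (x + s *: u) u) ->
  exists2 s, 0 < s < t & f (x + t *: u) - f x = t * 'D_u f (x + s *: u).
Proof.
move=> t0 fd.
have [] := @MVT R (fun s => f (x + s *: u)) (fun s => 'D_u f (x + s *: u)) 0 t t0.
- move=> s; rewrite in_itv /= => /andP [s0 st].
  by apply: is_derive_line; apply: fd; rewrite !ltW.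
- apply: derivable_within_continuous => s; rewrite in_itv /= => st.
  by have [] := is_derive_line (fd s st).
move=> s; rewrite in_itv /= => st E; exists s => //.
by rewrite scale0r addr0 subr0 in E; rewrite E mulrC.
Qed.

Lemma MVT_line_sym f x u (t : R) :
  (forall s, `|s| <= `|t| -> derivable f (x + s *: u) u) ->
  exists2 s, `|s| <= `|t| & f (x + t *: u) - f x = t * 'D_u f (x + s *: u).
Proof.
move=> fd; have [t0|t0|->] := ltgtP t 0.
- have [||s sb E] := @MVT_line f (x + t *: u) u (- t).
  + by rewrite oppr_gt0.
  + move=> s sb; rewrite -addrA -scalerDl; apply: fd.
    by rewrite [`|t|]ltr0_norm // ler_norml; lra.
  exists (t + s); first by rewrite [`|t|]ltr0_norm // ler_norml; lra.
  move: E; rewrite -!addrA -!scalerDl subrr scale0r addr0; lra.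
- have [||s sb E] := @MVT_line f x u t => //.
    by move=> s sb; apply: fd; rewrite [`|t|]gtr0_norm // ler_norml; lra.
  by exists s => //; rewrite [`|t|]gtr0_norm // ler_norml; lra.
by exists 0 => //; rewrite scale0r addr0 mul0r subrr.
Qed.

Lemma open_near U x : open U -> U x -> \forall y \near x, U y.
Proof. by move=> oU Ux; apply: open_nbhs_nbhs. Qed.

Lemma eq_on_near U f g x : open U -> (forall y, U y -> f y = g y) -> U x ->
  {near x, f =1 g}.
Proof. by move=> oU h Ux; apply: filterS (open_near oU Ux). Qed.

Lemma partial_congr U f g i x : open U -> (forall y, U y -> f y = g y) ->
  U x -> partial i f x = partial i g x.
Proof.
by move=> oU h Ux; apply: near_eq_derive; exact: eq_on_near h Ux.
Qed.

Lemma Cinfty_partial U f i : Cinfty U f -> Cinfty U (partial i f).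
Proof. by move=> h k; have [_ /(_ i) []] := h k.+1. Qed.

Lemma Cinfty_continuous U f x : Cinfty U f -> U x -> {for x, continuous f}.
Proof. by move=> /(_ 0%N) [h _]; apply: h. Qed.

Lemma Cinfty_derivable U f x i : Cinfty U f -> U x -> derivable f x (e_ i).
Proof. by move=> /(_ 1%N) [_ /(_ i) [h _]]; apply: h. Qed.

Definition partials f (w : seq 'I_n) := foldr (@partial R n) f w.

Lemma Cinfty_partials U f w : Cinfty U f -> Cinfty U (partials f w).
Proof. by move=> h; elim: w => //= i w; apply: Cinfty_partial. Qed.

Lemma near_scale x (u : 'rV[R]_n) (P : 'rV[R]_n -> Prop) :
  (\forall y \near x, P y) ->
  exists2 d : R, 0 < d & forall s, `|s| < d -> P (x + s *: u).
Proof.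
move=> /nbhs_ballP [d /= d0 hd].
exists (d / (1 + `|u|)); first by rewrite divr_gt0 // ltr_pwDl.
move=> s sd; apply: hd; rewrite -ball_normE /= opprD addrA subrr sub0r normrN.
rewrite normrZ; rewrite ltr_pdivlMr ?ltr_pwDl // in sd.
apply: le_lt_trans sd; rewrite ler_wpM2l // ler_wpDl //.
Qed.

Lemma near_scale2 x (u1 u2 : 'rV[R]_n) (P : 'rV[R]_n -> Prop) :
  (\forall y \near x, P y) ->
  exists2 d : R, 0 < d & forall s1 s2, `|s1| < d -> `|s2| < d ->
    P (x + s1 *: u1 + s2 *: u2).
Proof.
move=> /nbhs_ballP [d /= d0 hd].
have D0 : 0 < 1 + `|u1| + `|u2| by rewrite -addrA ltr_pwDl // addr_ge0.
exists (d / (1 + `|u1| + `|u2|)); first by rewrite divr_gt0.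
move=> s1 s2; rewrite !ltr_pdivlMr // => h1 h2.
apply: hd; rewrite -ball_normE /= !opprD !addrA subrr sub0r.
apply: le_lt_trans (ler_normD _ _) _; rewrite !normrN !normrZ.
have := normr_ge0 s1; have := normr_ge0 s2.
have := normr_ge0 u1; have := normr_ge0 u2.
have [s12|s12] := leP `|s1| `|s2|; last first.
  move: (`|s1|) (`|s2|) (`|u1|) (`|u2|) h1 h2 s12 => a b c e; nra.
move: (`|s1|) (`|s2|) (`|u1|) (`|u2|) h1 h2 s12 => a b c e; nra.
Qed.

(** The chain rule one coordinate at a time: only the mean value theorem along
    [e_ i] and the continuity of that partial derivative are used, so no notion of
    total differentiability intervenes. *)
Lemma is_derive_add_coord U f x u i (c L : R) : open U -> Cinfty U f -> U x ->
  is_derive x u f L -> is_derive x (u + c *: e_ i) f (L + c * partial i f x).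
Proof.
move=> oU fU Ux [fd fL].
suff C : (fun h : R => h^-1 *: ((f \o shift x) (h *: (u + c *: e_ i)) - f x))
   @ 0^' --> L + c * partial i f x.
  by apply: DeriveDef; [apply/cvg_ex; exists (L + c * partial i f x) | apply: cvg_lim].
have C1 : (fun h : R => h^-1 *: ((f \o shift x) (h *: u) - f x)) @ 0^' --> L.
  by rewrite -fL; exact: fd.
pose r (h : R) := h^-1 *: (f (x + h *: u + (h * c) *: e_ i) - f (x + h *: u)).
have -> : (fun h : R => h^-1 *: ((f \o shift x) (h *: (u + c *: e_ i)) - f x))
  = (fun h => h^-1 *: ((f \o shift x) (h *: u) - f x) + r h).
  apply/funext => h; rewrite /r -scalerDr; congr (_ *: _); rewrite /= /shift /=.
  rewrite scalerDr scalerA [h *: u + x]addrC.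
  by rewrite [_ + _ + x]addrC addrA; lra.
apply: (cvgD C1).
apply/cvgrPdist_le => eps eps0.
have /cvgrPdist_le /(_ _ (divr_gt0 eps0 (ltr_pwDl ltr01 (normr_ge0 c)))) hc :=
  Cinfty_continuous (Cinfty_partial i fU) Ux.
have hU := open_near oU Ux.
have [d1 d10 h1] := near_scale2 u (e_ i) (filterI hc hU).
have d0 : 0 < d1 / (1 + `|c|) by rewrite divr_gt0 // ltr_pwDl.
near=> h.
have hne : h != 0 by near: h; exact: nbhs_dnbhs_neq.
have hd : `|h| < d1 / (1 + `|c|).
  near: h; apply: dnbhs0_lt; exact: d0.
rewrite ltr_pdivlMr ?ltr_pwDl // in hd.
have hh : `|h| < d1.
  by apply: le_lt_trans hd; rewrite ler_peMr // lerDl.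
have hhc : `|h * c| < d1.
  by rewrite normrM; apply: le_lt_trans hd; rewrite ler_wpM2l // lerDr.
have [|s sb E] := @MVT_line_sym f (x + h *: u) (e_ i) (h * c).
  move=> s /le_lt_trans /(_ hhc) sd.
  by have [_ /(Cinfty_derivable fU)] := h1 _ _ hh sd.
rewrite /r E -/(partial i f _) -mulrA [_ *: _]mulrA mulVf // mul1r -mulrBr normrM.
have [+ _] := h1 _ _ hh (le_lt_trans sb hhc).
rewrite ler_pdivlMr ?ltr_pwDl //.
have := normr_ge0 c; set A := `|_ - _|; have : 0 <= A by exact: normr_ge0.
move: A (`|c|) => A C; nra.
Unshelve. all: by end_near. Qed.

Lemma is_derive_dir U f x u : open U -> Cinfty U f -> U x ->
  is_derive x u f (\sum_i u 0 i * partial i f x).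
Proof.
move=> oU fU Ux.
rewrite [X in is_derive x X](_ : u = \sum_i u 0 i *: e_ i); last first.
  by rewrite {1}[u]row_sum_delta.
elim: (index_enum _) => [|i s IH]; first by rewrite !big_nil; exact: is_derive0.
rewrite !big_cons addrC [X in is_derive _ _ _ X]addrC.
exact: (is_derive_add_coord _ _ oU fU Ux IH).
Qed.

(** The second difference over a square is a value of the mixed derivative, by the
    mean value theorem applied in each direction. *)
Lemma clairaut_box U f x i j (h : R) : Cinfty U f -> 0 < h ->
  (forall s t, 0 <= s <= h -> 0 <= t <= h -> U (x + s *: e_ i + t *: e_ j)) ->
  exists2 st : R * R, (0 <= st.1 <= h) && (0 <= st.2 <= h) &
  f (x + h *: e_ i + h *: e_ j) - f (x + h *: e_ i) - f (x + h *: e_ j) + f x =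
  h * (h * partial j (partial i f) (x + st.1 *: e_ i + st.2 *: e_ j)).
Proof.
move=> fU h0 hU.
have hh : 0 <= h <= h by rewrite lexx ltW.
have h00 : 0 <= (0 : R) <= h by rewrite lexx ltW.
pose g y := f (h *: e_ j + y) - f y.
have gd s : 0 <= s <= h -> is_derive (x + s *: e_ i) (e_ i) g
   (partial i f (h *: e_ j + (x + s *: e_ i)) - partial i f (x + s *: e_ i)).
  move=> sh; apply: is_deriveB.
    have := @Cinfty_derivable U f _ i fU (hU s h sh hh); rewrite addrC => d1.
    have E : (fun k : R => k^-1 *: (((fun y => f (h *: e_ j + y)) \o
         shift (x + s *: e_ i)) (k *: e_ i)
         - f (h *: e_ j + (x + s *: e_ i)))) =
      (fun k : R => k^-1 *: ((f \o shift (h *: e_ j + (x + s *: e_ i))) (k *: e_ i)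
         - f (h *: e_ j + (x + s *: e_ i)))).
      by apply/funext => k /=; rewrite /shift /= addrCA.
    by apply: DeriveDef; [rewrite /derivable E | rewrite /partial /derive E].
  have := @Cinfty_derivable U f _ i fU (hU s 0 sh h00); rewrite scale0r addr0 => d2.
  exact: DeriveDef.
have [|s sh E1] := @MVT_line g x (e_ i) h h0.
  by move=> s sh; have [] := gd s sh.
have sh' : 0 <= s <= h by lra.
have [|t th E2] := @MVT_line (partial i f) (x + s *: e_ i) (e_ j) h h0.
  by move=> t th; apply: Cinfty_derivable (Cinfty_partial i fU) (hU _ _ sh' th).
exists (s, t); first by rewrite /=; lra.
rewrite /= -[partial j _ _]/('D_(e_ j) _ _) -E2.
have [_ D] := gd s sh'.
rewrite D in E1; rewrite [x + s *: _ + _]addrC -E1 /g.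
by rewrite [h *: e_ j + (x + _)]addrC [h *: e_ j + x]addrC; lra.
Qed.

(** The second difference is symmetric in [i] and [j], so the two mixed derivatives
    take a common value at points of arbitrarily small squares. *)
Lemma clairaut U f x i j : open U -> Cinfty U f -> U x ->
  partial i (partial j f) x = partial j (partial i f) x.
Proof.
move=> oU fU Ux; apply/eqP; rewrite -subr_eq0 -normr_eq0; apply/eqP/le_anti.
rewrite normr_ge0 andbT; apply/ler_addgt0Pr => eps eps0; rewrite add0r.
have e2 : 0 < eps / 2 by rewrite divr_gt0.
have /cvgrPdist_le /(_ _ e2) hij :=
  Cinfty_continuous (Cinfty_partial i (Cinfty_partial j fU)) Ux.
have /cvgrPdist_le /(_ _ e2) hji :=
  Cinfty_continuous (Cinfty_partial j (Cinfty_partial i fU)) Ux.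
have hU := open_near oU Ux.
have [d1 d10 h1] := near_scale2 (e_ i) (e_ j) (filterI hji hU).
have [d2 d20 h2] := near_scale2 (e_ j) (e_ i) (filterI hij hU).
pose h := Num.min d1 d2 / 2.
have [h0 hd1 hd2] : [/\ 0 < h, h < d1 & h < d2].
  by rewrite /h /Num.min; case: ifP => H; split; lra.
have absb s d : 0 <= s <= h -> h < d -> `|s| < d.
  by move=> sh hd; rewrite ger0_norm; lra.
have [|[s t] /= /andP [sh th] E1] := @clairaut_box U f x i j h fU h0.
  by move=> s t sh th; have [] := h1 s t (absb _ _ sh hd1) (absb _ _ th hd1).
have [|[s' t'] /= /andP [sh' th'] E2] := @clairaut_box U f x j i h fU h0.
  by move=> s1 t1 sh1 th1; have [] := h2 s1 t1 (absb _ _ sh1 hd2) (absb _ _ th1 hd2).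
have [H1 _] := h1 s t (absb _ _ sh hd1) (absb _ _ th hd1).
have [H2 _] := h2 s' t' (absb _ _ sh' hd2) (absb _ _ th' hd2).
rewrite [x + h *: e_ j + _]addrAC in E2.
set A := partial j (partial i f) _ in E1 H1.
set B := partial i (partial j f) _ in E2 H2.
set A0 := partial j (partial i f) x in H1 *.
set B0 := partial i (partial j f) x in H2 *.
clearbody A B A0 B0.
have E : A = B.
  apply: (mulfI (lt0r_neq0 h0)); apply: (mulfI (lt0r_neq0 h0)).
  rewrite -E1 -E2; lra.
rewrite E in H1; rewrite -[X in X - _](subrK B) -addrA.
by apply: le_trans (ler_normD _ _) _; move: H1 H2; rewrite [`|B - A0|]distrC; lra.
Qed.

Lemma partials_perm U f w1 w2 x : open U -> Cinfty U f -> U x ->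
  perm_eq w1 w2 -> partials f w1 x = partials f w2 x.
Proof.
move=> oU fU.
have front w i y : i \in w -> U y ->
    partials f w y = partials f (i :: rem i w) y.
  elim: w y => [//|j w IH] y; rewrite inE /=; have [-> //|ij] := eqVneq j i.
  move=> /= iw Uy.
  rewrite (partial_congr j oU (fun z => IH z iw) Uy) /=.
  by apply: clairaut oU _ Uy; apply: Cinfty_partials.
elim: w1 w2 x => [|i w1 IH] w2 x Ux pw.
  by move: pw; rewrite perm_sym => /perm_nilP ->.
have iw2 : i \in w2 by rewrite -(perm_mem pw) mem_head.
rewrite (front w2 i x iw2 Ux) /=; apply: partial_congr oU _ Ux => y Uy.
apply: IH => //; rewrite -(perm_cons i).
by rewrite (permPl pw) perm_to_rem.
Qed.

Lemma Dmulti_partials f (alpha : multi_index) :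
  Dmulti alpha f = partials f (flatten [seq nseq (alpha i) i | i <- enum 'I_n]).
Proof.
rewrite /Dmulti; elim: (enum _) => //= i s ->.
by rewrite /partials foldr_cat; elim: (alpha i) => //= k ->.
Qed.

Lemma count_flatten_nseq (alpha : 'I_n -> nat) i :
  count_mem i (flatten [seq nseq (alpha j) j | j <- enum 'I_n]) = alpha i.
Proof.
rewrite count_flatten sumnE !big_map -enumT -/(index_enum _) big_enum /=.
rewrite (bigD1 i) //= count_nseq /= eqxx mul1n big1 ?addn0 // => j /negbTE ji.
by rewrite count_nseq /= ji.
Qed.

(** Links words with the sorted derivatives [Dmulti]. *)
Lemma partials_Dmulti U f w x : open U -> Cinfty U f -> U x ->
  partials f w x = Dmulti [ffun i => count_mem i w] f x.
Proof.
move=> oU fU Ux; rewrite Dmulti_partials; apply: (partials_perm oU fU Ux).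
by apply/allP => i _ /=; rewrite count_flatten_nseq ffunE.
Qed.

Lemma morder_count w : morder [ffun i : 'I_n => count_mem i w] = size w.
Proof.
rewrite /morder; elim: w => [|j w IH]; first by rewrite big1 // => i _; rewrite ffunE.
rewrite /= -IH (bigD1 j) //= [X in _ = X.+1](bigD1 j) //= !ffunE /= eqxx add1n addSn.
by congr (_ + _).+1; apply: eq_bigr => i ij; rewrite !ffunE /= eq_sym (negbTE ij).
Qed.

End Calculus.

(** * Taylor polynomials *)

Section Taylor.
Context {R : realType} {n : nat}.
Implicit Types (f : 'rV[R]_n -> R) (U : set 'rV[R]_n) (x y u v : 'rV[R]_n).
Implicit Types (P Q : mpoly n R) (w : seq 'I_n).

(** Polynomials are centred at [v], the point where the pieces are compared. *)
Definition pfun v P := fun x => peval P (x - v).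

Lemma is_derive_pfun v P x u :
  is_derive x u (pfun v P) (peval (pdir u P) (x - v)).
Proof.
pose q := pline P (x - v) u.
have qd : is_derive (0 : R) (1 : R) (horner q) (peval (pdir u P) (x - v)).
  have := derivableP (@derivable_horner R q 0).
  rewrite -derive1E -derivE /q deriv_pline horner_pline scale0r addr0.
  exact.
case: qd => [qd qE].
have E : (fun h : R => h^-1 *: ((pfun v P \o shift x) (h *: u) - pfun v P x))
       = (fun h : R => h^-1 *: ((horner q \o shift 0) (h *: 1) - q.[0])).
  apply/funext => h; rewrite /= /shift /= addr0 [h%:A]mulr1 !horner_pline scale0r addr0.
  by rewrite /pfun [h *: u + x]addrC addrAC.
by apply: DeriveDef; [rewrite /derivable E | rewrite /derive E].
Qed.

Lemma partial_pfun v P i : partial i (pfun v P) = pfun v (mderiv i P).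
Proof.
apply/funext => x; rewrite /partial; have [_ ->] := is_derive_pfun v P x (delta_mx 0 i).
by rewrite pdir_delta.
Qed.

Lemma partials_pfun v P w : partials (pfun v P) w = pfun v (pderivs P w).
Proof. by elim: w => //= i w ->; rewrite partial_pfun. Qed.

Lemma continuous_peval P : continuous (peval P).
Proof.
elim/mpolyind: P => [|c m P _ _ IH] x.
  rewrite (_ : peval 0 = cst 0); first exact: cst_continuous.
  by apply/funext => y; rewrite /peval meval0.
rewrite (_ : peval _ = (fun y => c * (\prod_i y 0 i ^+ m i) + peval P y)); last first.
  by apply/funext => y; rewrite /peval mevalD mevalZ mevalX.
have cX i k : {for x, continuous (fun y : 'rV[R]_n => y 0 i ^+ k)}.
  elim: k => [|k IHk]; first exact: cst_continuous.
  rewrite (_ : (fun y => _) = (fun y : 'rV[R]_n => y 0 i * y 0 i ^+ k)).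
    exact: (continuousM (@coord_continuous R 1 n 0 i x) IHk).
  by apply/funext => y; rewrite exprS.
have cprod s : {for x, continuous (fun y : 'rV[R]_n => \prod_(i <- s) y 0 i ^+ m i)}.
  elim: s => [|i s IHs].
    rewrite (_ : (fun y => _) = cst 1); first exact: cst_continuous.
    by apply/funext => y; rewrite big_nil.
  rewrite (_ : (fun y => _) =
    (fun y : 'rV[R]_n => y 0 i ^+ m i * \prod_(j <- s) y 0 j ^+ m j)).
    exact: continuousM (cX i (m i)) IHs.
  by apply/funext => y; rewrite big_cons.
apply: continuousD (IH x).
exact: continuousM (@cst_continuous _ _ c x) (cprod _).
Qed.

Lemma continuous_pfun v P : continuous (pfun v P).
Proof.
move=> x; apply: (@continuous_comp _ _ _ (fun y => y - v) (peval P)).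
  exact: (@continuousB _ _ _ id (cst v) x (@cvg_id _ _) (@cst_continuous _ _ v x)).
exact: continuous_peval.
Qed.

Lemma Cinfty_pfun v P U : Cinfty U (pfun v P).
Proof.
move=> k; elim: k P => [|k IH] P; split => //; try by move=> x _; exact: continuous_pfun.
move=> i; rewrite partial_pfun; split => // x _.
by have [] := is_derive_pfun v P x (delta_mx 0 i).
Qed.

Lemma peval0 Q : peval Q 0 = mcoeff mnm0 Q.
Proof.
elim/mpolyind: Q => [|c m P _ _ IH]; first by rewrite /peval meval0 mcoeff0.
rewrite /peval mevalD mcoeffD -/(peval P 0) IH mevalZ mcoeffZ mevalX mcoeffX.
congr (_ * _ + _); have [->|m0] := eqVneq m mnm0.
  by rewrite big1 // => i _; rewrite mnm0E expr0.
have [i mi] : exists i, m i != 0%N.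
  apply/existsP; rewrite -negb_forall; apply: contra m0 => /forallP h.
  by apply/eqP/mnmP => i; rewrite mnm0E; apply/eqP/h.
by rewrite (bigD1 i) //= mxE expr0n (negbTE mi) mul0r.
Qed.

(** The multi-index of a word counts its letters. *)
Lemma pderivs_mderivm P w :
  pderivs P w = mderivm (Multinom [tuple count_mem i w | i < n]) P.
Proof.
rewrite mderivm_foldr; apply: mderiv_perm; apply/allP => i _ /=.
by rewrite count_flatten_nseq mnmE.
Qed.

(** The coefficients are the divided sorted derivatives of [f]; equality for every
    word, in any order, is where the symmetry of mixed derivatives is needed. *)
Lemma taylor_exists U f v d : open U -> Cinfty U f -> U v ->
  exists2 P : mpoly n R, (msize P <= d.+1)%N &
    forall w, (size w <= d)%N -> peval (pderivs P w) 0 = partials f w v.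
Proof.
move=> oU fU Uv.
pose D (m : multinom n) := partials f (flatten [seq nseq (m i) i | i <- enum 'I_n]) v.
pose c (m : multinom n) : R := D m / (\prod_(i < n) (m i)`!)%:R.
pose P : mpoly n R := \sum_(m : bmultinom n d.+1) c m *: mpolyX R m.
have Pc (m : multinom n) : (mdeg m < d.+1)%N -> mcoeff m P = c m.
  move=> md; rewrite raddf_sum (bigD1 (BMultinom md)) //= big1 ?addr0.
    by rewrite mcoeffZ mcoeffX eqxx mulr1.
  move=> m' m'm; rewrite mcoeffZ mcoeffX.
  by have /negbTE -> : (m' : multinom n) != m; rewrite ?mulr0.
exists P.
  apply: leq_trans (msize_sum _ _ _) _; apply/bigmax_leqP => m _.
  by apply: leq_trans (msizeZ_le _ _) _; rewrite msizeX; exact: bmdeg.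
move=> w wd; rewrite peval0 pderivs_mderivm mcoeff_mderivm addm0.
set m := Multinom _.
have md : (mdeg m < d.+1)%N.
  rewrite ltnS mdegE; apply: leq_trans wd; rewrite -(morder_count w) /morder.
  by apply/eq_leq/eq_bigr => i _; rewrite mnmE ffunE.
rewrite Pc // /c [X in _ *+ X](eq_bigr (fun i => (m i)`!)%N) => [|i _]; last by rewrite ffactnn.
rewrite -[LHS]mulr_natr divfK; last first.
  by rewrite pnatr_eq0 -lt0n prodn_gt0 // => i; exact: fact_gt0.
apply: (partials_perm oU fU Uv); apply/allP => i _ /=.
by rewrite count_flatten_nseq mnmE.
Qed.

(** Taylor formula on a ray.  By induction on [d]: the derivative of the error along
    the ray is a combination of the errors of the partial derivatives, which are
    [o (t ^+ d)], and the mean value theorem gains one power of [t]. *)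
Lemma taylor_little_o U f v x P d : open U -> Cinfty U f -> U v ->
  (forall w, (size w <= d)%N -> peval (pderivs P w) 0 = partials f w v) ->
  forall eps, 0 < eps -> exists2 del, 0 < del &
    forall t, 0 < t < del -> `|f (v + t *: x) - peval P (t *: x)| <= eps * t ^+ d.
Proof.
move=> oU; elim: d f P => [|d IH] f P fU Uv h eps eps0.
  have e2 : 0 < eps / 2 by rewrite divr_gt0.
  have /cvgrPdist_le /(_ _ e2) h1 := Cinfty_continuous fU Uv.
  have /cvgrPdist_le /(_ _ e2) h2 := @continuous_pfun v P v.
  have [del del0 hd] := near_scale x (filterI h1 h2).
  exists del => // t /andP [t0 td]; rewrite expr0 mulr1.
  have [/= ha hb] : `|f v - f (v + t *: x)| <= eps / 2 /\
      `|pfun v P v - pfun v P (v + t *: x)| <= eps / 2.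
    by apply: hd; rewrite gtr0_norm.
  move: ha hb; rewrite /pfun subrr [v + _ - v]addrAC subrr add0r.
  have /= -> := h [::] isT.
  set a := f (v + _); set b := peval P _; set c := f v => ha hb.
  rewrite (_ : a - b = (c - b) - (c - a)); last by lra.
  by apply: le_trans (ler_normB _ _) _; lra.
pose B := 1 + \sum_i `|x 0 i|.
have B0 : 0 < B by rewrite ltr_pwDl // sumr_ge0.
have step i : exists del, 0 < del /\ forall t, 0 < t < del ->
    `|partial i f (v + t *: x) - peval (mderiv i P) (t *: x)| <= eps / B * t ^+ d.
  have [||del del0 hd] := IH (partial i f) (mderiv i P) (Cinfty_partial i fU) Uv _ (eps / B).
  - move=> w wd; have := h (rcons w i); rewrite size_rcons => /(_ wd).
    by rewrite /pderivs /partials !foldr_rcons.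
  - by rewrite divr_gt0.
  by exists del.
have [del hdel] := choice step.
have [d0 d00 hU] := near_scale x (open_near oU Uv).
exists (\big[Order.min/d0]_i del i).
  by elim/big_ind: _ => // [a b a0 b0|i _]; [rewrite lt_min a0 b0|case: (hdel i)].
move=> t /andP [t0 tdel].
have td0 : t < d0 by apply: lt_le_trans tdel _; exact: bigmin_le_id.
have tdi i : t < del i by apply: lt_le_trans tdel _; exact: bigmin_le.
have Us s : 0 <= s <= t -> U (v + s *: x).
  by move=> st; apply: hU; rewrite ger0_norm; lra.
pose F s := f (v + s *: x) - (pline P 0 x).[s].
pose dF s := \sum_i x 0 i * (partial i f (v + s *: x) - peval (mderiv i P) (s *: x)).
have Fd s : 0 <= s <= t -> is_derive s (1 : R) F (dF s).
  move=> st; have [fd fE] := is_derive_dir x oU fU (Us _ st).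
  have h1 := is_derive_line fd; rewrite fE in h1.
  have h2 := derivableP (@derivable_horner R (pline P 0 x) s).
  rewrite -derive1E -derivE deriv_pline horner_pline add0r in h2.
  have := is_deriveB h1 h2; congr is_derive.
  rewrite /dF /pdir peval_sum -sumrB; apply: eq_bigr => i _.
  by rewrite pevalZ -mulrBr.
have [s||] := @MVT R F dF 0 t t0.
- by rewrite in_itv /= => st; apply: Fd; lra.
- apply: derivable_within_continuous => s; rewrite in_itv /= => st.
  by have [] := Fd s st.
move=> s; rewrite in_itv /= => /andP [s0 st] E.
have F0 : F 0 = 0.
  rewrite /F scale0r addr0 horner_pline scale0r addr0.
  by have /= -> := h [::] isT; rewrite subrr.
rewrite F0 !subr0 /F horner_pline add0r in E; rewrite E normrM (gtr0_norm t0).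
rewrite exprSr mulrA ler_wpM2r ?(ltW t0) //.
have -> : eps = eps / B * B by rewrite divfK // gt_eqF.
rewrite -mulrA [B * _]mulrC mulrA.
apply: le_trans (ler_norm_sum _ _ _) _.
apply: (@le_trans _ _ (\sum_i `|x 0 i| * (eps / B * t ^+ d))).
  apply: ler_sum => i _; rewrite normrM ler_wpM2l //.
  have [_ /(_ s) hi] := hdel i.
  apply: le_trans (hi _) _; first by rewrite s0 (lt_trans st).
  by rewrite ler_wpM2l ?divr_ge0 ?(ltW eps0) ?(ltW B0) // lerXn2r ?nnegrE ?ltW.
rewrite -mulr_suml mulrC ler_wpM2l // ?lerDr //.
by rewrite mulr_ge0 ?divr_ge0 ?exprn_ge0 ?ltW.
Qed.

Lemma poly_little_o (q : {poly R}) d : (size q <= d.+1)%N ->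
  (forall eps, 0 < eps -> exists2 del, 0 < del &
    forall t, 0 < t < del -> `|q.[t]| <= eps * t ^+ d) -> q = 0.
Proof.
elim: d q => [|d IH] q sq h.
  have [c Dq] : exists c, q = c%:P by exists q`_0; apply: size1_polyC.
  suff c0 : `|c| <= 0 by move: c0; rewrite Dq normr_le0 => /eqP ->.
  apply/ler_addgt0Pr => eps eps0; rewrite add0r.
  have [del del0 hd] := h eps eps0.
  by have := hd (del / 2); rewrite Dq hornerC expr0 mulr1; apply; lra.
have q0 : q.[0] = 0.
  suff c0 : `|q.[0]| <= 0 by apply/eqP; rewrite -normr_le0.
  apply/ler_addgt0Pr => eps eps0; rewrite add0r.
  have e2 : 0 < eps / 2 by rewrite divr_gt0.
  have [del del0 hd] := h _ e2.
  have /cvgrPdist_le /(_ _ e2) /nbhs_ballP [d1 /= d10 h1] :=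
    @continuous_horner R q 0.
  pose m := Num.min (Num.min del d1) 1; pose t := m / 2.
  have m0 : 0 < m by rewrite !lt_min del0 d10 ltr01.
  have [m1 m2 m3] : [/\ m <= del, m <= d1 & m <= 1].
    by rewrite !ge_min !lexx !orbT.
  have [t0 td td1 t1] : [/\ 0 < t, t < del, t < d1 & t <= 1].
    by rewrite /t; split; lra.
  have H2 : `|q.[0] - q.[t]| <= eps / 2.
    by apply: h1; rewrite -ball_normE /= sub0r normrN gtr0_norm.
  have H3 : `|q.[t]| <= eps / 2.
    apply: le_trans (hd t _) _; first by rewrite t0.
    by rewrite ler_piMr ?(ltW e2) // exprn_ile1 // ltW.
  rewrite -[q.[0]](subrK q.[t]); apply: le_trans (ler_normD _ _) _; lra.
have /factor_theorem [q1 Dq] : root q 0 by apply/rootP.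
rewrite Dq (IH q1) ?mul0r //.
  have [->|q10] := eqVneq q1 0; first by rewrite size_poly0.
  by move: sq; rewrite Dq size_Mmonic ?monicXsubC // size_XsubC addn2.
move=> eps eps0; have [del del0 hd] := h eps eps0; exists del => // t td.
have := hd t td; rewrite Dq hornerM hornerXsubC subr0 normrM.
have /andP [t0 _] := td.
by rewrite (gtr0_norm t0) exprSr mulrA ler_pM2r.
Qed.

(** If two smooth functions have the same derivative [w] on a short ray issued from
    [v], the corresponding derivative of [P1 - P2] is [o (t ^+ (d - size w))] on the
    ray, while its degree is at most [d - size w]; hence it is zero there. *)
Lemma taylor_agree U1 U2 f1 f2 v x P1 P2 d (tau : R) w :
  open U1 -> open U2 -> Cinfty U1 f1 -> Cinfty U2 f2 -> U1 v -> U2 v ->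
  (msize P1 <= d.+1)%N -> (msize P2 <= d.+1)%N ->
  (forall w, (size w <= d)%N -> peval (pderivs P1 w) 0 = partials f1 w v) ->
  (forall w, (size w <= d)%N -> peval (pderivs P2 w) 0 = partials f2 w v) ->
  (size w <= d)%N -> 0 < tau ->
  (forall t, 0 < t < tau ->
    partials f1 w (v + t *: x) = partials f2 w (v + t *: x)) ->
  peval (pderivs (P1 - P2) w) x = 0.
Proof.
move=> oU1 oU2 fU1 fU2 Uv1 Uv2 s1 s2 h1 h2 wd tau0 hagree.
have sub U f P : (forall w, (size w <= d)%N -> peval (pderivs P w) 0 = partials f w v) ->
  forall w', (size w' <= d - size w)%N ->
    peval (pderivs (pderivs P w) w') 0 = partials (partials f w) w' v.
  move=> h w' w'd; rewrite -pderivs_cat h; first by rewrite /partials foldr_cat.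
  by rewrite size_cat; lia.
suff : pline (pderivs (P1 - P2) w) 0 x = 0.
  move/(congr1 (fun q : {poly R} => q.[1])).
  by rewrite horner_pline add0r scale1r horner0.
apply: (@poly_little_o _ (d - size w)).
  apply: leq_trans (size_pline _ _ _) _.
  have : forall Q : mpoly n R, (msize (pderivs Q w) <= msize Q - size w)%N.
    move=> Q; elim: (w) => [|i w' IHw] /=; first by rewrite subn0.
    by apply: leq_trans (msize_mderiv _ _) _; rewrite subnS -!subn1 leq_sub2r.
  move=> /(_ (P1 - P2)) h; apply: leq_trans h _.
  rewrite -subSn // leq_sub2r //; apply: leq_trans (msizeD_le _ _) _.
  by rewrite msizeN geq_max s1.
move=> eps eps0.
have e2 : 0 < eps / 2 by rewrite divr_gt0.
have [d1 d10 H1] := taylor_little_o x oU1 (Cinfty_partials w fU1) Uv1 (sub U1 f1 P1 h1) e2.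
have [d2 d20 H2] := taylor_little_o x oU2 (Cinfty_partials w fU2) Uv2 (sub U2 f2 P2 h2) e2.
exists (Num.min tau (Num.min d1 d2)); first by rewrite !lt_min tau0 d10 d20.
move=> t /andP [t0]; rewrite !lt_min => /and3P [tt t1 t2].
have := H1 t; rewrite t0 t1 => /(_ isT) K1.
have := H2 t; rewrite t0 t2 => /(_ isT) K2.
rewrite horner_pline add0r pderivsB pevalB.
have := hagree t; rewrite t0 tt => /(_ isT) A.
rewrite A in K1; move: K1 K2.
move: (partials _ _ _) (peval _ _) (peval _ _) (t ^+ _) => a b c e K1 K2.
rewrite (_ : c - b = (a - b) - (a - c)); last by lra.
by apply: le_trans (ler_normB _ _) _; lra.
Qed.

End Taylor.

(** * Convex hulls *)

Section Hulls.
Context {R : realType} {n : nat}.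
Implicit Types (A B : set 'rV[R]_n) (x y : 'rV[R]_n).

Lemma convex_setP A : @convex_set R 'rV[R]_n A <->
  forall x y (t : R), 0 <= t <= 1 -> A x -> A y -> A (t *: x + (1 - t) *: y).
Proof.
split=> [cA x y t /andP [t0 t1] Ax Ay|cA x y t].
  have := cA x y (Itv01 t0 t1) (mem_set Ax) (mem_set Ay).
  by move=> /set_mem.
move=> /set_mem Ax /set_mem Ay; apply/mem_set; apply: cA => //.
by rewrite ge0 le1.
Qed.

Lemma sub_hull A : A `<=` convex_hull A.
Proof. exact: sub_gen_smallest. Qed.

Lemma convex_hull_convex A : @convex_set R 'rV[R]_n (convex_hull A).
Proof.
apply/convex_setP => x y t t01 hx hy B [cB AB].
have cB' := (convex_setP B).1 cB.
by apply: cB' t01 _ _; [exact: hx (conj cB AB)|exact: hy (conj cB AB)].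
Qed.

Lemma hull_sub A B : A `<=` convex_hull B -> convex_hull A `<=` convex_hull B.
Proof. by move=> AB; apply: smallest_sub => //; exact: convex_hull_convex. Qed.

Lemma join_hull x A : join x (convex_hull A) = convex_hull (x |` A).
Proof.
apply/seteqP; split; apply: hull_sub => y.
  case=> [->|]; first by apply: sub_hull; left.
  by apply: hull_sub => z Az; apply: sub_hull; right.
by case=> [->|Ay]; apply: sub_hull; [left|right; apply: sub_hull].
Qed.

(** Indexing by all of ['I_m] with coefficients supported in [D] lets a simplex and
    its faces share the same coordinates. *)
Lemma hullP m (p : 'I_m -> 'rV[R]_n) (D : set 'I_m) x :
  convex_hull (p @` D) x <-> exists c : 'I_m -> R,
    [/\ forall i, 0 <= c i, forall i, ~ D i -> c i = 0, \sum_i c i = 1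
      & x = \sum_i c i *: p i].
Proof.
split.
  apply: (@smallest_sub _ _ _ [set x | exists c : 'I_m -> R,
    [/\ forall i, 0 <= c i, forall i, ~ D i -> c i = 0, \sum_i c i = 1
      & x = \sum_i c i *: p i]]).
    apply/convex_setP => y z t /andP [t0 t1] [c [c0 cD cs ->]] [d [d0 dD ds ->]].
    exists (fun i => t * c i + (1 - t) * d i); split.
    - by move=> i; rewrite addr_ge0 // mulr_ge0 // subr_ge0.
    - by move=> i nD; rewrite cD // dD // !mulr0 addr0.
    - by rewrite big_split -!mulr_sumr /= cs ds; lra.
    rewrite !scaler_sumr -big_split; apply: eq_bigr => i _ /=.
    by rewrite !scalerA -scalerDl.
  move=> _ [i Di <-]; exists (fun j => (j == i)%:R); split.
  - by move=> j; rewrite ler0n.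
  - by move=> j nDj; case: eqP => // E; case: nDj; rewrite E.
  - by rewrite (bigD1 i) //= eqxx big1 ?addr0 // => j /negbTE ->.
  rewrite (bigD1 i) //= eqxx scale1r big1 ?addr0 // => j /negbTE ->.
  by rewrite scale0r.
move=> [c [c0 cD cs ->]] B [/convex_setP cB pB].
(* Partial sums are normalized, since a convex set only has binary combinations. *)
suff key : forall s : seq 'I_m, 0 < \sum_(i <- s) c i ->
    B ((\sum_(i <- s) c i)^-1 *: \sum_(i <- s) c i *: p i).
  by have := key (index_enum _); rewrite cs invr1 scale1r; apply.
elim=> [|i s IH]; first by rewrite big_nil ltxx.
rewrite !big_cons; set S := \sum_(j <- s) c j; set P := \sum_(j <- s) _ => cS.
have S0 : 0 <= S by apply: sumr_ge0.
have [Dci|ci0] := eqVneq (c i) 0.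
  by move: cS; rewrite Dci add0r scale0r add0r => /IH.
have Bp : B (p i).
  apply: pB; exists i => //; apply: contrapT => nD.
  by move: ci0; rewrite cD // eqxx.
have [DS|S1] := eqVneq S 0.
  have -> : P = 0.
    have : all (fun j => c j == 0) s.
      by move: DS => /eqP; rewrite psumr_eq0.
    move=> /allP h; rewrite /P big_seq big1 // => j /h /eqP ->.
    by rewrite scale0r.
  by rewrite DS !addr0 scalerA mulVf // scale1r.
have Sp : 0 < S by rewrite lt_def S1.
have -> : (c i + S)^-1 *: (c i *: p i + P) =
   (c i / (c i + S)) *: p i + (1 - c i / (c i + S)) *: (S^-1 *: P).
  rewrite scalerDr !scalerA; congr (_ *: _ + _ *: _); first by rewrite mulrC.
  by field; rewrite S1 gt_eqF.
apply: cB => //; last exact: IH.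
by rewrite divr_ge0 ?(c0 i) ?(ltW cS) //= ler_pdivrMr // mul1r lerDl.
Qed.

End Hulls.

(** * The split in barycentric coordinates *)

Section Delta.
Context {R : realType} {I : finType}.

Lemma sum_delta (i : I) : \sum_k (k == i)%:R = 1 :> R.
Proof. by rewrite (bigD1 i) //= eqxx big1 ?addr0 // => k /negbTE ->. Qed.

Lemma sum_delta_scale (V : lmodType R) (i : I) (f : I -> V) :
  \sum_k (k == i)%:R *: f k = f i.
Proof.
rewrite (bigD1 i) //= eqxx scale1r big1 ?addr0 // => k /negbTE ->.
by rewrite scale0r.
Qed.

End Delta.

Section Barycentric.
Context {R : realType} {n : nat}.
Variables (a : 'I_n.+1 -> 'rV[R]_n) (v : 'rV[R]_n) (w : 'I_n.+1 -> 'rV[R]_n).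

Lemma affinely_independent_uniq c d : affinely_independent a ->
  \sum_i c i = \sum_i d i -> \sum_i c i *: a i = \sum_i d i *: a i -> c =1 d.
Proof.
move=> ia h1 h2 i; apply/eqP; rewrite -subr_eq0; apply/eqP.
apply: (ia (fun i => c i - d i)).
  by rewrite sumrB h1 subrr.
rewrite (eq_bigr (fun i => c i *: a i - d i *: a i)) => [|j _]; last by rewrite scalerBl.
by rewrite sumrB h2 subrr.
Qed.

(** A coordinate that vanished would become negative when moving from [v] away from
    [a i], while the moved point is still in the simplex. *)
Lemma interior_barycentric : affinely_independent a ->
  interior (convex_hull (range a)) v ->
  exists lam : 'I_n.+1 -> R,
    [/\ forall i, 0 < lam i, \sum_i lam i = 1 & v = \sum_i lam i *: a i].
Proof.
move=> ia vint.
have [c [c0 _ cs Dv]] := (hullP a setT v).1 (interior_subset vint).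
exists c; split => // i.
have [del del0 hd] := near_scale (v - a i) vint.
have h2 : `|del / 2| < del by rewrite gtr0_norm; lra.
have [d [d0 _ ds Dd]] := (hullP a setT _).1 (hd _ h2).
have E : forall k, d k = c k + (del / 2) * (c k - (k == i)%:R).
  apply: affinely_independent_uniq => //.
    rewrite ds big_split /= cs -mulr_sumr sumrB cs.
    by rewrite sum_delta; lra.
  rewrite -Dd (eq_bigr (fun k => c k *: a k + (del / 2) *: (c k *: a k - (k == i)%:R *: a k))).
    rewrite big_split /= -Dv -scaler_sumr sumrB -Dv.
    by rewrite sum_delta_scale.
  by move=> k _; rewrite scalerDl -scalerA scalerBl.
have := d0 i; rewrite E eqxx /=; have := c0 i.
rewrite le_eqVlt => /orP [/eqP <-|//]; lra.
Qed.

(** The weights [lam] are those for which the edges sum to zero. *)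
Definition edge (lam : 'I_n.+1 -> R) i := lam i *: (a i - v).

(** All that is used of the split: [w i] lies on the line through [v] and [a i], and
    its coordinate on [a i] is zero, which determines its position as
    [v - (1 - lam i)^-1 *: edge lam i]. *)
Lemma split_edges : (2 <= n)%N -> is_split a v w -> aligned a v w ->
  exists lam : 'I_n.+1 -> R,
    [/\ forall i, 0 < lam i < 1,
        \sum_i edge lam i = 0,
        forall xi : 'I_n.+1 -> R, \sum_i xi i *: edge lam i = 0 -> forall i j, xi i = xi j
      & forall i, w i = v - (1 - lam i)^-1 *: edge lam i].
Proof.
move=> n2 [ia vint _] al.
have [lam [lam0 lams Dv]] := interior_barycentric ia vint.
have lam1 i : lam i < 1.
  rewrite -lams (bigD1 i) //= ltrDl.
  have [k ki] : exists k, k != i.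
    exists (if i == ord0 then ord_max else ord0).
    by case: ifP => [/eqP ->|/negbT]; rewrite 1?eq_sym // -val_eqE /=; lia.
  rewrite (bigD1 k) //= ltr_pwDl // sumr_ge0 // => j _; exact: ltW.
exists lam; split.
- by move=> i; rewrite lam0 lam1.
- rewrite (eq_bigr (fun i => lam i *: a i - lam i *: v)) => [|i _]; last by rewrite /edge scalerBr.
  by rewrite sumrB -scaler_suml lams scale1r -Dv subrr.
- move=> xi h; pose X := \sum_i xi i * lam i.
  suff key i : xi i = X by move=> i j; rewrite !key.
  have : (fun i => xi i * lam i) =1 (fun i => X * lam i).
    apply: affinely_independent_uniq => //; first by rewrite -mulr_sumr lams mulr1.
    rewrite [RHS](eq_bigr (fun i => X *: (lam i *: a i))) => [|j _]; last by rewrite scalerA.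
    rewrite -scaler_sumr -Dv; apply/eqP; rewrite -subr_eq0; apply/eqP; rewrite -[RHS]h.
    rewrite /X scaler_suml -[LHS]sumrB; apply: eq_bigr => j _.
    by rewrite /edge scalerA scalerBr.
  by move=> /(_ i) /(mulIf (lt0r_neq0 (lam0 i))).
move=> i.
have [fw [p [d hl]]] : (facet a i `&` [set y | collinear y v (a i)]) (w i) by rewrite al.
have [t1 _ E1] := hl (w i) (or_introl (or_introl erefl)).
have [t2 _ E2] := hl v (or_introl (or_intror erefl)).
have [t3 _ E3] := hl (a i) (or_intror erefl).
have [c [c0 cD cs Dw]] := (hullP a _ _).1 fw.
have ci : c i = 0 by apply: cD => /=; apply.
have t23 : t2 != t3.
  apply/eqP => t23.
  have va : v = a i by rewrite -E2 t23 E3.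
  have : lam =1 (fun k => (k == i)%:R).
    apply: affinely_independent_uniq => //.
      by rewrite lams sum_delta.
    by rewrite -Dv va sum_delta_scale.
  by move=> /(_ i); rewrite eqxx => L; have := lam1 i; rewrite L ltxx.
pose s := (t1 - t2) / (t3 - t2).
have t32 : t3 - t2 != 0 by rewrite subr_eq0 eq_sym.
have Ew : w i = v + s *: (a i - v).
  rewrite -E1 -E2 -E3 /s opprD addrACA subrr add0r -scalerBl scalerA divfK //.
  by rewrite -addrA -scalerDl [t2 + _]addrC subrK.
clearbody s.
have E : c =1 (fun k => (1 - s) * lam k + s * (k == i)%:R).
  apply: affinely_independent_uniq => //.
    by rewrite cs big_split -!mulr_sumr /= lams sum_delta; lra.
  rewrite -Dw Ew (eq_bigr (fun k => (1 - s) *: (lam k *: a k) + s *: ((k == i)%:R *: a k))).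
    rewrite big_split -!scaler_sumr /= -Dv sum_delta_scale.
    by rewrite scalerBl scale1r scalerBr addrAC addrA.
  by move=> k _; rewrite [LHS]scalerDl !scalerA.
have := E i; rewrite ci eqxx mulr1 => Es.
have l1 : 1 - lam i != 0 by rewrite subr_eq0 eq_sym lt_eqF.
rewrite Ew /edge scalerA -scaleNr; congr (_ + _ *: _).
apply: (mulIf l1); rewrite mulNr -mulrA [lam i * _]mulrC mulKf //; lra.
Qed.

End Barycentric.

(** * The cells as chambers *)

Section Cells.
Context {R : realType} {n : nat}.
Variables (a : 'I_n.+1 -> 'rV[R]_n) (v : 'rV[R]_n) (w : 'I_n.+1 -> 'rV[R]_n).
Variable lam : 'I_n.+1 -> R.
Let b := edge a v lam.
Hypothesis lam01 : forall i, 0 < lam i < 1.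
Hypothesis sumb : \sum_i b i = 0.
Hypothesis bindep : forall xi : 'I_n.+1 -> R, \sum_i xi i *: b i = 0 -> forall i j, xi i = xi j.
Hypothesis Dw : forall i, w i = v - (1 - lam i)^-1 *: b i.

(** The vertices of the cell [(i, j)] are indexed like those of the simplex, [w i]
    replacing [a i] and [v] replacing [a j]; so two adjacent cells share the labels
    of their common vertices. *)
Definition cell_vertex i j k := if k == j then v else if k == i then w i else a k.

Definition cell i j := convex_hull (range (cell_vertex i j)).

(** The coefficient of [cell_vertex i j k - v] on the edge [k]; its sign is what
    makes the cell a chamber. *)
Definition cell_slope i j k : R :=
  if k == j then 0 else if k == i then - (1 - lam i)^-1 else (lam k)^-1.

Lemma cell_vertexE i j k : cell_vertex i j k = v + cell_slope i j k *: b k.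
Proof.
rewrite /cell_vertex /cell_slope; case: eqP => _; first by rewrite scale0r addr0.
case: eqP => [->|_]; first by rewrite Dw scaleNr.
have /andP [l0 _] := lam01 k.
by rewrite /b /edge scalerA mulVf ?gt_eqF // scale1r addrC subrK.
Qed.

Lemma split_cellE T : split_cell a v w T <-> exists i j, i != j /\ T = cell i j.
Proof.
suff E i j : i != j ->
    Defs.join v (Defs.join (w i) (convex_hull (a @` (~` [set i; j])))) = cell i j.
  by split=> -[i [j [ij ->]]]; exists i, j; rewrite E.
move=> ij; rewrite !join_hull; congr convex_hull; apply/seteqP; split => y.
  case=> [->|[->|[k /= kij <-]]].
  - by exists j => //; rewrite /cell_vertex eqxx.
  - by exists i => //; rewrite /cell_vertex (negbTE ij) eqxx.
  - exists k => //; rewrite /cell_vertex.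
    by case: eqP => [E|_]; [case: kij; right|case: eqP => [E|//]; case: kij; left].
case=> k _ <-; rewrite /cell_vertex; case: eqP => [_|kj]; first by left.
by case: eqP => [_|ki]; right; [left|right; exists k => // -[]].
Qed.

Lemma ptb_shift xi c : pt b (fun l => xi l + c) = pt b xi.
Proof.
have -> : pt b xi = pt b xi + c *: \sum_i b i by rewrite sumb scaler0 addr0.
rewrite /pt scaler_sumr -big_split.
by apply: eq_bigr => l _; rewrite scalerDl.
Qed.

Lemma ptb_inj xi eta : pt b xi = pt b eta -> forall k l, xi k - eta k = xi l - eta l.
Proof.
move=> E; apply: bindep.
rewrite (eq_bigr (fun k => xi k *: b k - eta k *: b k)) => [|k _]; last by rewrite scalerBl.
by rewrite sumrB -[X in X - _]/(pt b xi) E subrr.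
Qed.

Lemma cell_coords i j (D : set 'I_n.+1) x :
  convex_hull (cell_vertex i j @` D) x <-> exists c : 'I_n.+1 -> R,
    [/\ forall k, 0 <= c k, forall k, ~ D k -> c k = 0, \sum_k c k = 1
      & x = v + pt b (fun k => c k * cell_slope i j k)].
Proof.
have E c : \sum_k c k = 1 -> \sum_k c k *: cell_vertex i j k
    = v + pt b (fun k => c k * cell_slope i j k).
  move=> cs; rewrite -[v in RHS]scale1r -cs scaler_suml -big_split.
  by apply: eq_bigr => k _; rewrite cell_vertexE scalerDr scalerA.
rewrite hullP; split=> -[c [c0 cD cs ->]]; exists c; split => //.
  exact: E.
by rewrite E.
Qed.

Lemma cell_slope_lt0 i j : i != j -> cell_slope i j i < 0.
Proof.
move=> ij; rewrite /cell_slope (negbTE ij) eqxx oppr_lt0 invr_gt0 subr_gt0.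
by have /andP [] := lam01 i.
Qed.

Lemma cell_slope_gt0 i j k : k != i -> k != j -> 0 < cell_slope i j k.
Proof.
move=> ki kj; rewrite /cell_slope (negbTE ki) (negbTE kj) invr_gt0.
by have /andP [] := lam01 k.
Qed.

Lemma cell_slopejj i j : cell_slope i j j = 0.
Proof. by rewrite /cell_slope eqxx. Qed.

Lemma cell_slope_eq0 i j k : i != j -> k != j -> cell_slope i j k != 0.
Proof.
move=> ij kj; have [->|ki] := eqVneq k i; first by rewrite lt_eqF // cell_slope_lt0.
by rewrite gt_eqF // cell_slope_gt0.
Qed.

Definition chamber i j (xi : 'I_n.+1 -> R) :=
  xi i <= xi j /\ forall k, k != i -> xi j <= xi k.

Lemma cell_chamber i j xi : i != j -> cell i j (v + pt b xi) -> chamber i j xi.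
Proof.
move=> ij /cell_coords [c [c0 _ cs /addrI E]].
have D k : xi k = xi j + c k * cell_slope i j k.
  have := ptb_inj E k j; rewrite cell_slopejj mulr0; lra.
split.
  by rewrite D gerDl mulr_ge0_le0 // ltW // cell_slope_lt0.
move=> k ki; rewrite (D k) lerDl; have [->|kj] := eqVneq k j.
  by rewrite cell_slopejj mulr0.
by rewrite mulr_ge0 // ltW // cell_slope_gt0.
Qed.

(** Subtracting [xi j] from all coordinates leaves the point unchanged and makes
    every coordinate a nonnegative multiple of the slope; near [v] the sum of these
    multiples is at most one, and [v] itself, in slot [j], takes the rest. *)
Lemma chamber_cell i j xi : i != j -> chamber i j xi ->
  exists2 tau : R, 0 < tau & forall t, 0 <= t <= tau -> cell i j (v + t *: pt b xi).
Proof.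
move=> ij [xij xjk].
pose eta k := xi k - xi j; pose m k := eta k / cell_slope i j k.
have m0 k : 0 <= m k.
  have [->|kj] := eqVneq k j; first by rewrite /m /eta subrr mul0r.
  have [->|ki] := eqVneq k i.
    by rewrite /m mulr_le0 ?invr_le0 ?subr_le0 // ltW // cell_slope_lt0.
  by rewrite /m divr_ge0 ?subr_ge0 ?xjk // ltW // cell_slope_gt0.
pose S := \sum_k m k.
have S0 : 0 <= S by apply: sumr_ge0.
exists (1 + S)^-1; first by rewrite invr_gt0 ltr_pwDl.
move=> t /andP [t0 t1].
have tS : t * S <= 1.
  rewrite -(@mulVf _ (1 + S)) ?gt_eqF ?ltr_pwDl //.
  by apply: ler_pM => //; rewrite lerDr.
apply/cell_coords; exists (fun k => t * m k + (k == j)%:R * (1 - t * S)); split => //.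
- by move=> k; rewrite addr_ge0 // mulr_ge0 ?m0 ?ler0n // subr_ge0.
- by move=> k nT; case: nT.
- rewrite /= big_split -mulr_sumr -mulr_suml sum_delta /= -/S; lra.
congr (_ + _).
rewrite -(ptb_shift xi (- xi j)) /pt scaler_sumr; apply: eq_bigr => k _.
rewrite scalerA; congr (_ *: _); rewrite -/(eta k).
have [->|kj] := eqVneq k j; first by rewrite cell_slopejj mulr0 /eta subrr mulr0.
by rewrite mul0r addr0 /m -mulrA divfK // cell_slope_eq0.
Qed.

Lemma cell_affinely_independent i j : i != j -> affinely_independent (cell_vertex i j).
Proof.
move=> ij c cs cp.
have E : \sum_k (c k * cell_slope i j k) *: b k = 0.
  rewrite -[RHS]cp [RHS](eq_bigr (fun k => c k *: v + (c k * cell_slope i j k) *: b k)).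
    by rewrite big_split /= -scaler_suml cs scale0r add0r.
  by move=> k _; rewrite cell_vertexE scalerDr scalerA.
have ck k : k != j -> c k = 0.
  move=> kj; apply/eqP; have /eqP := bindep E k j.
  by rewrite cell_slopejj mulr0 mulf_eq0 (negbTE (cell_slope_eq0 ij kj)) orbF.
move=> k; have [->|/ck //] := eqVneq k j.
by rewrite -cs (bigD1 j) //= big1 ?addr0.
Qed.

Lemma cell_vertex_in i j k : cell i j (cell_vertex i j k).
Proof. by apply: sub_hull; exists k. Qed.

(** Two cells meet in a common facet as soon as they share all vertices but one and
    the coordinate [d] of the missing vertex is forced to be [xi j], that is, has
    coefficient zero in the first cell. *)
Lemma cell_facet i j k l d : (0 < n)%N -> i != j ->
  (forall m, m != d -> exists m', cell_vertex i j m = cell_vertex k l m') ->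
  (forall xi, chamber i j xi -> chamber k l xi -> xi d = xi j) -> d != j ->
  k != l -> is_face n.-1 (cell i j `&` cell k l) (cell i j).
Proof.
move=> n0 ij sub eqd dj kl.
exists n, (cell_vertex i j), (fun m => lift d (cast_ord (prednK n0) m)).
split => //.
- exact: cell_affinely_independent.
- by move=> m m' /lift_inj /cast_ord_inj.
have -> : range (cell_vertex i j \o (fun m => lift d (cast_ord (prednK n0) m)))
    = cell_vertex i j @` (~` [set d]).
  apply/seteqP; split => y.
    case=> m _ <-; exists (lift d (cast_ord (prednK n0) m)) => //= E.
    by move/eqP: E; rewrite eq_sym (negbTE (neq_lift _ _)).
  case=> m /= md <-; have /unlift_some [m' Dm _] : d != m by apply/eqP => E; apply: md; rewrite E.
  exists (cast_ord (esym (prednK n0)) m') => //=.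
  by rewrite cast_ordKV -Dm.
apply/seteqP; split => x.
  case=> xij xkl; have [c [c0 _ cs Dx]] := (cell_coords i j setT x).1 xij.
  apply/cell_coords; exists c; split => // m /= /contrapT ->.
  rewrite Dx in xij xkl.
  have /= := eqd _ (cell_chamber ij xij) (cell_chamber kl xkl).
  rewrite cell_slopejj mulr0 => /eqP.
  by rewrite mulf_eq0 (negbTE (cell_slope_eq0 ij dj)) orbF => /eqP.
move=> hx; split; apply: hull_sub hx => y [m /= /eqP md <-].
  exact: cell_vertex_in.
by have [m' ->] := sub m md; exact: cell_vertex_in.
Qed.

Lemma cell_adjacent_same i j k : (0 < n)%N -> j != i -> k != i -> j != k ->
  is_face n.-1 (cell i j `&` cell i k) (cell i j).
Proof.
move=> n0 ji ki jk; apply: (@cell_facet i j i k k) => //; rewrite 1?eq_sym //.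
- move=> m mk; have [->|mj] := eqVneq m j.
    by exists k; rewrite /cell_vertex !eqxx.
  by exists m; rewrite /cell_vertex (negbTE mj) (negbTE mk).
move=> xi [_ h1] [_ h2]; have := h1 k ki; have := h2 j ji.
by move=> A B; apply/le_anti; rewrite A B.
Qed.

Lemma cell_adjacent_swap i j : (0 < n)%N -> i != j ->
  is_face n.-1 (cell i j `&` cell j i) (cell i j).
Proof.
move=> n0 ij; have ji : j != i by rewrite eq_sym.
apply: (@cell_facet i j j i i) => //.
- move=> m mi; have [->|mj] := eqVneq m j.
    by exists i; rewrite /cell_vertex !eqxx.
  by exists m; rewrite /cell_vertex (negbTE mj) (negbTE mi).
by move=> xi [h1 _] [h2 _]; apply/le_anti; rewrite h1 h2.
Qed.

End Cells.

(** * Supersmoothness of the smooth splines *)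

Section EdgeBasis.
Context {R : realType} {n : nat} (b : 'I_n.+1 -> 'rV[R]_n).
Hypothesis bindep : forall xi : 'I_n.+1 -> R, \sum_i xi i *: b i = 0 -> forall i j, xi i = xi j.

(** The edges other than the first form a basis, and [C] is the inverse of its
    matrix: [x *m C] gives the coordinates normalized by [xi ord0 = 0]. *)
Lemma edge_dual_basis : exists C : 'M[R]_n,
  (forall x : 'rV[R]_n, x = \sum_k (x *m C) 0 k *: b (lift ord0 k)) /\
  (forall l k, (b (lift ord0 l) *m C) 0 k = (l == k)%:R).
Proof.
pose M : 'M[R]_n := \matrix_k b (lift ord0 k).
have rowM k : row k M = b (lift ord0 k) by rewrite rowK.
have Mu : M \in unitmx.
  rewrite -row_free_unit; apply: inj_row_free => z zM.
  pose xi l := if unlift ord0 l is Some k then z 0 k else 0.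
  have xi0 : xi ord0 = 0 by rewrite /xi unlift_none.
  apply/rowP => k; rewrite mxE -xi0.
  have -> : z 0 k = xi (lift ord0 k) by rewrite /xi liftK.
  apply: bindep; rewrite big_ord_recl xi0 scale0r add0r -[RHS]zM mulmx_sum_row.
  by apply: eq_bigr => l _; rewrite rowM /xi liftK.
exists (invmx M); split=> [x|l k].
  rewrite -[LHS](mulmxKV Mu) mulmx_sum_row.
  by apply: eq_bigr => k _; rewrite rowM.
by rewrite -rowM -row_mul mulmxV // !mxE.
Qed.

Lemma edges_span x : exists xi, x = pt b xi.
Proof.
have [C [hC _]] := edge_dual_basis.
exists (fun l => if unlift ord0 l is Some k then (x *m C) 0 k else 0).
rewrite {1}[x]hC /pt big_ord_recl unlift_none scale0r add0r.
by apply: eq_bigr => k _; rewrite liftK.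
Qed.

End EdgeBasis.

Lemma pderivs_ext (R : realFieldType) n (P Q : mpoly n R) w x :
  (forall y, peval P y = peval Q y) ->
  peval (pderivs P w) x = peval (pderivs Q w) x.
Proof.
move=> h; apply/eqP; rewrite -subr_eq0 -pevalB -pderivsB; apply/eqP.
have {h} : forall y, peval (P - Q) y = 0 by move=> y; rewrite pevalB h subrr.
move: (P - Q) => {P}Q h; elim: w x => [|i w IH] x //=.
by rewrite -[mderiv i _]pdir_delta; apply: pdir_eval0 => t.
Qed.

Section Upper.
Context {R : realType} {n : nat}.
Variables (a : 'I_n.+1 -> 'rV[R]_n) (v : 'rV[R]_n) (w : 'I_n.+1 -> 'rV[R]_n).
Variable lam : 'I_n.+1 -> R.
Let b := edge a v lam.
Hypothesis n2 : (2 <= n)%N.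
Hypothesis lam01 : forall i, 0 < lam i < 1.
Hypothesis sumb : \sum_i b i = 0.
Hypothesis bindep : forall xi : 'I_n.+1 -> R, \sum_i xi i *: b i = 0 -> forall i j, xi i = xi j.
Hypothesis Dw : forall i, w i = v - (1 - lam i)^-1 *: b i.
Variables (r : nat) (sigma : spline_family (R := R) (n := n)).
Hypothesis smooth : smooth_splines r (split_cell a v w) sigma.
Let k := (r.+1)./2.
Let rho := (r + (n - 2) * k)%N.
Local Notation cell := (cell a v w).

Let n0 : (0 < n)%N. Proof. by apply: leq_trans n2. Qed.

Let cell_in i j : i != j -> split_cell a v w (cell i j).
Proof. by move=> ij; apply/split_cellE; exists i, j. Qed.

Let apex i j : cell i j v.
Proof. by have := @cell_vertex_in R n a v w i j j; rewrite /cell_vertex eqxx. Qed.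

Variable P : 'I_n.+1 -> 'I_n.+1 -> mpoly n R.
Hypothesis Psize : forall i j, i != j -> (msize (P i j) <= rho.+1)%N.
Hypothesis Ptaylor : forall i j, i != j -> forall s, (size s <= rho)%N ->
  peval (pderivs (P i j) s) 0 = partials (sigma (cell i j)) s v.

(** Near [v] the two cells share the points of the relative interior of the wall
    between the chambers.  Taylor polynomials agree there by [taylor_agree], and
    then on the whole wall, because from any point of the wall a suitable direction
    [eta] eventually enters the common face. *)
Let vanish_on_wall i j i' j' p q : i != j -> i' != j' ->
  is_face n.-1 (cell i j `&` cell i' j') (cell i j) ->
  is_face n.-1 (cell i j `&` cell i' j') (cell i' j') ->
  (forall xi : 'I_n.+1 -> R, xi p = xi q -> exists eta M, forall t, M < t ->
     chamber i j (fun l => xi l + t * eta l) /\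
     chamber i' j' (fun l => xi l + t * eta l)) ->
  vanish r (wall b p q) (P i j - P i' j').
Proof.
move=> ij ij' F1 F2 inner s sr _ [xi xipq ->].
have [eta [M hM]] := inner xi xipq.
suff : pline (pderivs (P i j - P i' j') s) (pt b xi) (pt b eta) = 0.
  move=> /(congr1 (fun q : {poly R} => q.[0])).
  by rewrite horner_pline scale0r addr0 horner0.
apply: (@poly_eventually0 _ _ M) => t /hM [c1 c2].
rewrite horner_pline ptD; set zeta := fun l => _ in c1 c2 *.
have [hs hr] := smooth.
have [oU sU fU] := hs _ (cell_in ij).
have [oU' sU' fU'] := hs _ (cell_in ij').
have [t1 t10 h1] := chamber_cell lam01 sumb Dw ij c1.
have [t2 t20 h2] := chamber_cell lam01 sumb Dw ij' c2.
apply: (@taylor_agree R n _ _ _ _ v (pt b zeta) (P i j) (P i' j') rho (Num.min t1 t2) s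
  oU oU' fU fU' (sU _ (@apex i j)) (sU' _ (@apex i' j')) (Psize ij) (Psize ij')
  (Ptaylor ij) (Ptaylor ij')).
- by apply: leq_trans sr _; rewrite leq_addr.
- by rewrite lt_min t10.
move=> u /andP [u0]; rewrite lt_min => /andP [u1 u2].
have m1 : cell i j (v + u *: pt b zeta) by apply: h1; rewrite !ltW.
have m2 : cell i' j' (v + u *: pt b zeta) by apply: h2; rewrite !ltW.
rewrite (partials_Dmulti s oU fU (sU _ m1)) (partials_Dmulti s oU' fU' (sU' _ m2)).
apply: (hr _ _ (cell_in ij) (cell_in ij') F1 F2) => //.
by rewrite morder_count.
Qed.

Let vanish_same i j j' : j != i -> j' != i -> j != j' ->
  vanish r (wall b j j') (P i j - P i j').
Proof.
move=> ji ji' jj'.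
have ij : i != j by rewrite eq_sym.
have ij' : i != j' by rewrite eq_sym.
apply: vanish_on_wall => //.
- exact: (cell_adjacent_same lam01 bindep Dw).
- by rewrite setIC; apply: (cell_adjacent_same lam01 bindep Dw); rewrite // eq_sym.
move=> xi xijj.
(* The direction points into the relative interior of the common face. *)
exists (fun l => if l == i then -1 else if (l == j) || (l == j') then 0 else 1).
exists (\sum_i `|xi i| *+ 2) => t tM.
have t0 := le_lt_trans (spread_ge0 xi) tM.
have B l m := spread_le xi l m.
split; (split; first by rewrite eqxx ?(negbTE ji) ?(negbTE ji') ?eqxx ?orbT /=;
    have := B i j; rewrite -?xijj; lra);
  move=> l li; rewrite ?(negbTE ji) ?(negbTE ji') ?(negbTE li) ?eqxx ?orbT /= -?xijj;
  (case: eqVneq => [->|_] /=; first by lra);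
  (case: eqVneq => [->|_] /=; first by rewrite -?xijj; lra);
  have := B j l; lra.
Qed.

Let vanish_swap i j : i != j -> vanish r (wall b i j) (P i j - P j i).
Proof.
move=> ij; have ji : j != i by rewrite eq_sym.
apply: vanish_on_wall => //.
- exact: (cell_adjacent_swap lam01 bindep Dw).
- by rewrite setIC; apply: (cell_adjacent_swap lam01 bindep Dw).
move=> xi xiij.
exists (fun l => if (l == i) || (l == j) then 0 else 1).
exists (\sum_i `|xi i| *+ 2) => t tM.
have t0 := le_lt_trans (spread_ge0 xi) tM.
have B l m := spread_le xi l m.
split; (split; first by rewrite !eqxx ?orbT /= xiij; lra); move=> l li;
  rewrite ?eqxx ?orbT /= (negbTE li) /= -?xiij ?orbF;
  (case: eqVneq => [->|_] /=; first by rewrite -?xiij; lra); have := B i l; lra.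
Qed.

Let size_others (i : 'I_n.+1) : size [seq j <- enum 'I_n.+1 | j != i] = n.
Proof.
rewrite size_filter; have := count_predC (pred1 i) (enum 'I_n.+1).
rewrite size_enum_ord count_uniq_mem ?enum_uniq // mem_enum => /eqP.
by rewrite add1n eqSS => /eqP.
Qed.

Let k2 : (k.*2 <= r.+1)%N.
Proof. by rewrite /k -[X in (_ <= X)%N]odd_double_half leq_addl. Qed.

Let rho_bound (i : 'I_n.+1) :
  (rho + k <= r + (size [seq j <- enum 'I_n.+1 | j != i]).-1 * k)%N.
Proof.
rewrite size_others /rho -addnA leq_add2l -mulSnr leq_mul2r; apply/orP; right.
by move: n2; lia.
Qed.

Let taylor_same i j j' x : j != i -> j' != i ->
  peval (P i j) x = peval (P i j') x.
Proof.
move=> ji ji'; have [xi ->] := edges_span bindep x.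
apply: (alfeld_rigidity (b := b) (p := P i) (d := rho) k2 _ _ _ (rho_bound i)).
- by rewrite filter_uniq // enum_uniq.
- by move=> l m; rewrite !mem_filter => /andP [li _] /andP [mi _]; apply: vanish_same.
- by move=> l; rewrite mem_filter eq_sym => /andP [li _]; apply: Psize.
- by rewrite mem_filter ji mem_enum.
- by rewrite mem_filter ji' mem_enum.
Qed.

Let third (i j : 'I_n.+1) : exists l, (l != i) && (l != j).
Proof.
have [l hl|h] := pickP (fun l => (l != i) && (l != j)); first by exists l.
have : ([set: 'I_n.+1] \subset [set i; j])%SET.
  apply/fintype.subsetP => l _; rewrite !inE.
  by have /negbT := h l; rewrite negb_and !negbK.
move=> /subset_leq_card; rewrite cardsT card_ord cards2.
by move: n2; case: (i != j) => /=; lia.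
Qed.

(** First [j] is changed for fixed [i], then [i] among all indices but one, [m]; the
    latter is possible because there are at least three indices. *)
Lemma taylor_all_equal i j i' j' x : i != j -> i' != j' ->
  peval (P i j) x = peval (P i' j') x.
Proof.
move=> ij ij'.
have ji : j != i by rewrite eq_sym.
have ji' : j' != i' by rewrite eq_sym.
have [Eii|ii'] := eqVneq i i'; first by subst i'; apply: taylor_same.
have [m /andP [mi mi']] := third i i'.
have [z hz] := choice (fun l => third l l).
pose p l := P l (z l).
have zl l : z l != l by have /andP [] := hz l.
have -> : peval (P i j) x = peval (p i) x by apply: taylor_same.
have -> : peval (P i' j') x = peval (p i') x by apply: taylor_same.
have [xi ->] := edges_span bindep x.
apply: (alfeld_rigidity (b := b) (p := p) (d := rho) k2 _ _ _ (rho_bound m)).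
- by rewrite filter_uniq // enum_uniq.
- move=> l q _ _ lq s sr y wy.
  have ql : q != l by rewrite eq_sym.
  rewrite (@pderivs_ext _ _ _ (P l q - P q l)).
    exact: vanish_swap.
  by move=> y'; rewrite !pevalB; congr (_ - _); apply: taylor_same.
- by move=> l _; apply: Psize; rewrite eq_sym.
- by rewrite mem_filter eq_sym mi mem_enum.
- by rewrite mem_filter eq_sym mi' mem_enum.
Qed.

End Upper.

Lemma size_word n (alpha : multi_index (n := n)) :
  size (flatten [seq nseq (alpha i) i | i <- enum 'I_n]) = morder alpha.
Proof.
rewrite -morder_count; congr morder; apply/ffunP => i.
by rewrite ffunE count_flatten_nseq.
Qed.

Lemma smooth_supersmooth (R : realType) n (a : 'I_n.+1 -> 'rV[R]_n) v w r sigma :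
  (2 <= n)%N -> is_split a v w -> aligned a v w ->
  smooth_splines r (split_cell a v w) sigma ->
  supersmooth_splines (r + (n - 2) * (r.+1)./2)%N (split_cell a v w) v sigma.
Proof.
move=> n2 sp al sm.
have [lam [lam01 sumb bindep Dw]] := split_edges n2 sp al.
set rho := (r + _)%N.
have [hs _] := sm; split => // T1 T2 + + alpha ar.
have ex (ij : 'I_n.+1 * 'I_n.+1) : exists P : mpoly n R, ij.1 != ij.2 ->
    (msize P <= rho.+1)%N /\
    forall s, (size s <= rho)%N -> peval (pderivs P s) 0 =
      partials (sigma (cell a v w ij.1 ij.2)) s v.
  have [E|ne] := eqVneq ij.1 ij.2; first by exists 0.
  have [|oU sU fU] := hs (cell a v w ij.1 ij.2).
    by apply/split_cellE; exists ij.1, ij.2.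
  have [|P sP tP] := @taylor_exists R n _ _ v rho oU fU; last by exists P.
  by apply: sU; have := @cell_vertex_in R n a v w ij.1 ij.2 ij.2; rewrite /cell_vertex eqxx.
have [P hP] := choice ex.
move=> /split_cellE [i [j [ij ->]]] /split_cellE [i' [j' [ij' ->]]].
rewrite !Dmulti_partials.
have [_ <-] := hP (i, j) ij; last by rewrite size_word.
have [_ <-] := hP (i', j') ij'; last by rewrite size_word.
apply: pderivs_ext => x.
apply: (@taylor_all_equal R n a v w lam n2 lam01 sumb bindep Dw r sigma sm
  (fun i j => P (i, j))) => //.
- by move=> i1 j1 h1; have [] := hP (i1, j1) h1.
- by move=> i1 j1 h1; have [] := hP (i1, j1) h1.
Qed.

(** * Algebraic primitives *)

Section Primitive.
Context {A : comNzRingType} (nu : nat -> A).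
Hypothesis nuP : forall i, nu i * i.+1%:R = 1.
Implicit Types (Q W : {poly A}).

(** [nu i] stands for [1 / (i + 1)]; working over any commutative ring that has these
    inverses allows the coefficients to be polynomials in the coordinates. *)
Definition primitive Q : {poly A} := 'X * \poly_(i < size Q) (Q`_i * nu i).

Lemma coef_primitive Q i :
  (primitive Q)`_i = if i is i'.+1 then Q`_i' * nu i' else 0.
Proof.
rewrite coefXM; case: i => [|i] //=; rewrite coef_poly.
by case: ltnP => // /leq_sizeP -> //; rewrite mul0r.
Qed.

Lemma deriv_primitive Q : deriv (primitive Q) = Q.
Proof.
apply/polyP => i; rewrite coef_deriv coef_primitive -mulr_natr -mulrA nuP.
by rewrite mulr1.
Qed.

Lemma primitive_deriv Q : primitive (deriv Q) = Q - (Q.[0])%:P.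
Proof.
apply/polyP => -[|i]; rewrite coef_primitive coefB coefC /=.
  by rewrite horner_coef0 subrr.
by rewrite coef_deriv subr0 -mulr_natr -mulrA [_%:R * _]mulrC nuP mulr1.
Qed.

Lemma primitiveZ c Q : primitive (c *: Q) = c *: primitive Q.
Proof.
by apply/polyP => -[|i]; rewrite coefZ !coef_primitive ?mulr0 // coefZ mulrA.
Qed.

(** The substitution [t = y + s (x - y)] in the integral of [W] from [y] to [x]. *)
Lemma primitive_increment W x y : (primitive W).[x] - (primitive W).[y] =
  (x - y) * (primitive (W \Po (y%:P + (x - y) *: 'X))).[1].
Proof.
rewrite -hornerZ -primitiveZ.
have -> : (x - y) *: (W \Po (y%:P + (x - y) *: 'X)) =
    deriv (primitive W \Po (y%:P + (x - y) *: 'X)).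
  rewrite deriv_comp deriv_primitive derivD derivC add0r derivZ derivX.
  by rewrite alg_polyC mulrC mul_polyC.
rewrite primitive_deriv hornerD hornerN hornerC !horner_comp.
by rewrite !(hornerD, hornerC, hornerZ, hornerX) mulr1 mulr0 addr0 [y + _]addrC subrK.
Qed.

End Primitive.

Lemma map_primitive (A B : comNzRingType) (f : {rmorphism A -> B}) nu nu' (Q : {poly A}) :
  (forall i, f (nu i) = nu' i) ->
  map_poly f (primitive nu Q) = primitive nu' (map_poly f Q).
Proof.
move=> h; apply/polyP => i; rewrite coef_map !coef_primitive.
by case: i => [|i] /=; rewrite ?rmorph0 // coef_map rmorphM /= h.
Qed.

(** If the integral from [0] to [1] vanished, the integrand would have a root in
    between. *)
Lemma primitive_neq0 (R : realType) (S : {poly R}) :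
  (forall s, 0 < s < 1 -> S.[s] != 0) ->
  (primitive (fun i => i.+1%:R^-1) S).[1] != 0.
Proof.
move=> hS; apply/eqP => E.
have nuP i : (i.+1%:R^-1 : R) * i.+1%:R = 1 by rewrite mulVf ?pnatr_eq0.
set Q := primitive _ S in E *.
have Q0 : Q.[0] = 0 by rewrite /Q /primitive hornerM hornerX mul0r.
have [|||s] := @Rolle R (horner Q) 0 1 ltr01.
- by move=> x _; exact: derivable_horner.
- by apply: continuous_subspaceT => x; exact: continuous_horner.
- by rewrite Q0 E.
rewrite in_itv /= => s01 [_ ds].
have := hS s s01; rewrite -(deriv_primitive nuP S) -/Q derivE derive1E ds.
by rewrite eqxx.
Qed.

(** * Polynomials with prescribed contact *)

Section PowerVanishing.
Context {R : realFieldType} {n : nat}.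
Implicit Types (L S : mpoly n R).

Lemma pderivs_exp L S e w : (size w <= e)%N ->
  exists S', pderivs (L ^+ e * S) w = L ^+ (e - size w) * S'.
Proof.
have step i k S1 : exists S', mderiv i (L ^+ k.+1 * S1) = L ^+ k * S'.
  elim: k => [|k [S' IH]].
    by exists (mderiv i (L * S1)); rewrite expr1 expr0 mul1r.
  exists (mderiv i L * S1 + S').
  by rewrite exprS -mulrA mderivM IH exprS; ring.
elim: w => [|i w IH] we; first by exists S; rewrite subn0.
have [S1 /= ->] := IH (ltnW we).
by rewrite subnS; move: we => /=; rewrite -subn_gt0; case: (e - size w)%N.
Qed.

Lemma vanish_exp r e (H : 'rV[R]_n -> Prop) L S : (r < e)%N ->
  (forall x, H x -> peval L x = 0) -> vanish r H (L ^+ e * S).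
Proof.
move=> re HL w wr x /HL Lx.
have [S' ->] := pderivs_exp L S (leq_trans wr (ltnW re)).
rewrite pevalM /peval rmorphXn /= -/(peval L x) Lx expr0n.
by rewrite subn_eq0 leqNgt (leq_ltn_trans wr re) mul0r.
Qed.

End PowerVanishing.

(** After the substitution of [primitive_increment] the factors [j] and [l] are
    multiples of [y j - y l]. *)
Lemma prod_collapse (B : comNzRingType) n (kappa : 'I_n -> nat) (y : 'I_n -> B) j l :
  j != l -> exists T : {poly B},
  \prod_i ((y l)%:P + (y j - y l) *: 'X - (y i)%:P) ^+ kappa i =
    (y j - y l) ^+ (kappa j + kappa l) *: T.
Proof.
move=> jl.
exists (('X - 1) ^+ kappa j * ('X ^+ kappa l *
  \prod_(i | (i != j) && (i != l)) ((y l)%:P + (y j - y l) *: 'X - (y i)%:P) ^+ kappa i)).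
rewrite (bigD1 j) //= (bigD1 l) 1?eq_sym //=.
have -> : (y l)%:P + (y j - y l) *: 'X - (y j)%:P = (y j - y l) *: ('X - 1).
  by rewrite scalerBr alg_polyC polyCB opprB addrAC addrC.
have -> : (y l)%:P + (y j - y l) *: 'X - (y l)%:P = (y j - y l) *: 'X.
  by rewrite addrAC subrr add0r.
by rewrite !exprZn exprD -!scalerAl -!scalerAr !scalerA.
Qed.

Section MinSpline.
Context {R : realType} {n : nat} (C : 'M[R]_n) (kappa : 'I_n -> nat).
Local Notation A := (mpoly n R).

Definition coord_poly k : A := \sum_m C m k *: mpolyX R (mnm1 m).

Lemma peval_coord_poly k x : peval (coord_poly k) x = (x *m C) 0 k.
Proof.
rewrite peval_sum mxE; apply: eq_bigr => m _.
by rewrite pevalZ /peval mevalXU mulrC.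
Qed.

Let nu i : A := mpolyC n (i.+1%:R^-1).

Let nuP i : nu i * i.+1%:R = 1.
Proof.
have -> : (i.+1%:R : A) = mpolyC n i.+1%:R by rewrite rmorph_nat.
by rewrite -rmorphM /= mulVf ?pnatr_eq0 // rmorph1.
Qed.

Definition weight : {poly A} := \prod_l ('X - (coord_poly l)%:P) ^+ kappa l.

(** The integral from [0] to [y j] of the weight, as a polynomial in the
    coordinates [y]. *)
Definition piece j : A := (primitive nu weight).[coord_poly j].

Let comp_linear (B : comNzRingType) (y : 'I_n -> B) (g : {poly B}) :
  (\prod_l ('X - (y l)%:P) ^+ kappa l) \Po g = \prod_l (g - (y l)%:P) ^+ kappa l.
Proof.
rewrite rmorph_prod /=; apply: eq_bigr => l _.
by rewrite rmorphXn /= comp_polyB comp_polyX comp_polyC.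
Qed.

Lemma piece_diff j l : j != l -> exists S,
  piece j - piece l = (coord_poly j - coord_poly l) ^+ (kappa j + kappa l).+1 * S.
Proof.
move=> jl; rewrite /piece primitive_increment // comp_linear.
have [T ->] := prod_collapse kappa coord_poly jl.
by exists (primitive nu T).[1]; rewrite primitiveZ hornerZ exprS mulrA.
Qed.

(** Where all coordinates but the [j]-th vanish, the difference is homogeneous, and its
    coefficient is an integral of a weight without roots in [(0, 1)]. *)
Lemma piece_diff_line j l x t : j != l ->
  (forall i, (x *m C) 0 i = (i == j)%:R) ->
  peval (piece j - piece l) (t *: x) =
  t ^+ (\sum_i kappa i).+1 *
    (primitive (fun i => i.+1%:R^-1) (\prod_i ('X - ((i == j)%:R)%:P) ^+ kappa i)).[1].
Proof.
move=> jl hx; rewrite pevalB.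
pose f : {rmorphism A -> R} := meval (fun i => (t *: x) 0 i).
have fY i : f (coord_poly i) = t * (i == j)%:R.
  by rewrite -[LHS]/(peval _ _) peval_coord_poly -scalemxAl mxE hx.
have fF i : peval (piece i) (t *: x) =
    (primitive (fun i => i.+1%:R^-1)
       (\prod_i ('X - (t * (i == j)%:R)%:P) ^+ kappa i)).[t * (i == j)%:R].
  rewrite -[LHS]/(f _) /piece -horner_map fY; congr (_.[_]).
  rewrite (map_primitive (nu' := fun i => i.+1%:R^-1)) => [|q]; last exact: mevalC.
  congr primitive; rewrite rmorph_prod /=; apply: eq_bigr => q _.
  by rewrite rmorphXn /= rmorphB /= map_polyX map_polyC /= fY.
have nuPR i : (i.+1%:R^-1 : R) * i.+1%:R = 1 by rewrite mulVf ?pnatr_eq0.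
rewrite !fF eqxx [l == j]eq_sym (negbTE jl) mulr1 mulr0 primitive_increment // subr0.
rewrite comp_linear add0r exprS -mulrA; congr (_ * _).
rewrite -hornerZ -primitiveZ; congr (primitive _ _).[_].
rewrite -prodrXr -scaler_prod; apply: eq_bigr => i _.
by rewrite -exprZn ?polyC0 ?add0r scalerBr -[t *: _%:P]mul_polyC -polyCM.
Qed.

End MinSpline.

(** * A spline that is not smoother *)

Section Lower.
Context {R : realType} {n : nat}.
Variables (a : 'I_n.+1 -> 'rV[R]_n) (v : 'rV[R]_n) (w : 'I_n.+1 -> 'rV[R]_n).
Variable lam : 'I_n.+1 -> R.
Let b := edge a v lam.
Hypothesis lam01 : forall i, 0 < lam i < 1.
Hypothesis sumb : \sum_i b i = 0.
Hypothesis bindep : forall xi : 'I_n.+1 -> R, \sum_i xi i *: b i = 0 -> forall i j, xi i = xi j.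
Hypothesis Dw : forall i, w i = v - (1 - lam i)^-1 *: b i.
Variable C : 'M[R]_n.
Hypothesis dualC : forall l k, (b (lift ord0 l) *m C) 0 k = (l == k)%:R.
Local Notation cell := (cell a v w).

Definition min_region j : set 'rV[R]_n :=
  [set x | forall k, ((x - v) *m C) 0 j <= ((x - v) *m C) 0 k].

Lemma coord_pt xi k : (pt b xi *m C) 0 k = xi (lift ord0 k) - xi ord0.
Proof.
rewrite -(ptb_shift sumb xi (- xi ord0)) /pt big_ord_recl subrr scale0r add0r.
rewrite mulmx_suml summxE (bigD1 k) //= -scalemxAl mxE dualC eqxx mulr1.
rewrite big1 ?addr0 // => l lk.
by rewrite -scalemxAl mxE dualC (negbTE lk) mulr0.
Qed.

(** The chamber inequalities say that [xi i] is the smallest coordinate and [xi j] the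
    next one, so the smallest one besides [xi ord0] is [j] or [i] according to
    whether [i] is [ord0]. *)
Lemma cell_min_region i j : i != j -> exists k, cell i j `<=` min_region k.
Proof.
move=> ij.
have h x : cell i j x -> exists2 xi, x - v = pt b xi & chamber i j xi.
  have [xi Dx] := edges_span bindep (x - v) => hx; exists xi => //.
  by apply: (cell_chamber lam01 bindep Dw ij); rewrite -Dx addrC subrK.
have [i' Di|Di] := unliftP ord0 i.
  exists i' => x /h [xi E [h1 h2]] l /=; rewrite E !coord_pt lerD2r -Di.
  have [->//|li] := eqVneq (lift ord0 l) i.
  exact: le_trans h1 (h2 _ li).
have [j' Dj|Dj] := unliftP ord0 j; last by rewrite Di Dj eqxx in ij.
exists j' => x /h [xi E [h1 h2]] l /=; rewrite E !coord_pt lerD2r -Dj.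
by apply: h2; rewrite Di eq_sym neq_lift.
Qed.

(** The vertex [w (lift ord0 p)] has only one nonzero coordinate, which is negative. *)
Lemma min_region_first p k : cell (lift ord0 p) ord0 `<=` min_region k -> k = p.
Proof.
have pq : lift ord0 p != ord0 by rewrite eq_sym neq_lift.
have E (c : R) l : ((c *: b (lift ord0 p)) *m C) 0 l = c * (p == l)%:R.
  by rewrite -dualC; move: (b _) => u; rewrite -scalemxAl mxE.
move=> /(_ _ (@cell_vertex_in R n a v w _ _ (lift ord0 p))) /(_ p).
rewrite /cell_vertex (negbTE pq) eqxx Dw [v - _]addrC addrK -scaleNr !E.
rewrite eqxx; have [->//|pk] := eqVneq p k.
rewrite mulr0 mulr1 leNgt oppr_lt0 invr_gt0 subr_gt0.
by have /andP [_ ->] := lam01 (lift ord0 p).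
Qed.

Variable kappa : 'I_n -> nat.
Variable sel : set 'rV[R]_n -> 'I_n.
Hypothesis selP : forall i j, i != j -> cell i j `<=` min_region (sel (cell i j)).

(** Pieces are attached to cells, which are sets, so the index of the smallest
    coordinate is a choice function [sel] on sets. *)
Definition min_spline : spline_family (R := R) (n := n) :=
  fun T => LocalFun setT (pfun v (piece C kappa (sel T))).

(** Any two cells only meet where both selected coordinates are minimal, hence equal;
    whether they are adjacent does not matter. *)
Lemma min_spline_smooth r : (forall j l, j != l -> (r <= kappa j + kappa l)%N) ->
  smooth_splines r (split_cell a v w) min_spline.
Proof.
move=> hk; split.
  by move=> T _; split => //=; [exact: openT | exact: Cinfty_pfun].
move=> T1 T2 /split_cellE [i [j [ij ->]]] /split_cellE [i' [j' [ij' ->]]] _ _.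
move=> alpha ar x [x1 x2]; rewrite !Dmulti_partials /= !partials_pfun /pfun.
set s := flatten _; set k := sel _; set l := sel _.
have [-> //|kl] := eqVneq k l.
apply/eqP; rewrite -subr_eq0 -pevalB -pderivsB; apply/eqP.
have [S ->] := piece_diff C kappa kl.
apply: (@vanish_exp R n r _ (fun y => (y *m C) 0 k = (y *m C) 0 l)).
- by rewrite ltnS hk.
- by move=> y E; rewrite pevalB !peval_coord_poly E subrr.
- by rewrite size_word.
by apply/le_anti; rewrite (selP ij x1) (selP ij' x2).
Qed.

Lemma min_spline_not_supersmooth m : (2 <= n)%N -> (\sum_i kappa i < m)%N ->
  ~ supersmooth_splines m (split_cell a v w) v min_spline.
Proof.
move=> n2 mk [_ hss].
pose p : 'I_n := Ordinal (ltnW n2); pose q : 'I_n := Ordinal n2.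
have pq : p != q by [].
have T_ l : split_cell a v w (cell (lift ord0 l) ord0).
  by apply/split_cellE; exists (lift ord0 l), ord0; rewrite eq_sym neq_lift.
have selE l : sel (cell (lift ord0 l) ord0) = l.
  by apply: min_region_first; apply: selP; rewrite eq_sym neq_lift.
pose Q := piece C kappa p - piece C kappa q.
have vQ : vanish m (fun x => x = 0) Q.
  move=> s sm _ ->; rewrite /Q pderivsB pevalB.
  have := hss _ _ (T_ p) (T_ q) [ffun i => count_mem i s].
  rewrite morder_count => /(_ sm).
  rewrite -!(@partials_Dmulti R n setT) //=; try exact: openT; try exact: Cinfty_pfun.
  by rewrite !selE !partials_pfun /pfun subrr => ->; rewrite subrr.
pose u := b (lift ord0 p).
have hu i : (u *m C) 0 i = (i == p)%:R by rewrite dualC eq_sym.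
pose c := (primitive (fun i => i.+1%:R^-1) (\prod_i ('X - ((i == p)%:R)%:P) ^+ kappa i)).[1 : R].
have c0 : c != 0.
  apply: primitive_neq0 => s /andP [s0 s1]; rewrite horner_prod.
  apply/prodf_neq0 => i _; rewrite horner_exp hornerXsubC expf_neq0 // subr_eq0.
  by case: (i == p) => /=; [rewrite lt_eqF | rewrite gt_eqF].
have E : pline Q 0 u = c *: 'X^((\sum_i kappa i).+1).
  apply/eqP; rewrite -subr_eq0; apply/eqP; apply: (@poly_eventually0 _ _ 0) => t _.
  rewrite hornerD hornerN hornerZ hornerXn horner_pline add0r.
  by rewrite (piece_diff_line kappa t pq hu) mulrC subrr.
have := @vanish_pline R n m (fun x => x = 0) Q 0 u 0.
rewrite scale0r addr0 E => /(_ erefl vQ).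
have n0 : c *: 'X^((\sum_i kappa i).+1) != 0 :> {poly R}.
  by rewrite scaler_eq0 negb_or c0 -size_poly_eq0 size_polyXn.
move=> /(dvdp_leq n0); rewrite size_exp_XsubC size_scale // size_polyXn ltnS.
by move: mk; lia.
Qed.

End Lower.

(** The exponents are [k] except one equal to [r - k]: two of them sum to at least
    [r], and all of them to [r + (n - 2) * k]. *)
Lemma smooth_not_supersmooth (R : realType) n (a : 'I_n.+1 -> 'rV[R]_n) v w r m :
  (2 <= n)%N -> is_split a v w -> aligned a v w ->
  (r + (n - 2) * (r.+1)./2 < m)%N ->
  ~ (smooth_splines r (split_cell a v w) `<=`
     supersmooth_splines m (split_cell a v w) v).
Proof.
move=> n2 sp al rm sub.
have [lam [lam01 sumb bindep Dw]] := split_edges n2 sp al.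
have [C [_ dualC]] := edge_dual_basis bindep.
set k := (r.+1)./2 in rm.
have kr : (k <= r)%N by rewrite /k; lia.
have k2 : (r <= k + k)%N by rewrite /k; lia.
pose p : 'I_n := Ordinal (ltnW n2).
pose kappa (i : 'I_n) := if i == p then (r - k)%N else k.
have ex (T : set 'rV[R]_n) : exists j, (exists j', T `<=` min_region v C j') ->
    T `<=` min_region v C j.
  have [[j hj]|no] := pselect (exists j, T `<=` min_region v C j).
    by exists j.
  by exists p.
have [sel selP] := choice ex.
have selcell i j : i != j -> cell a v w i j `<=` min_region v C (sel (cell a v w i j)).
  by move=> ij; apply: selP; apply: (cell_min_region lam01 sumb bindep Dw dualC).
apply: (@min_spline_not_supersmooth R n a v w lam lam01 Dw C dualC kappa sel selcell m n2).
  apply: leq_ltn_trans rm.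
  rewrite (bigD1 p) //= /kappa eqxx (eq_bigr (fun=> k)) => [|i /negbTE -> //].
  rewrite sum_nat_const cardC1 card_ord.
  have -> : n.-1 = (n - 2).+1 by lia.
  by rewrite mulSn addnA subnK.
apply: sub; apply: (min_spline_smooth selcell) => j l jl.
rewrite /kappa; case: eqP => [Dj|_]; case: eqP => [Dl|_] //.
- by rewrite Dj Dl eqxx in jl.
- by rewrite subnK.
- by rewrite subnKC.
Qed.

Theorem theorem5 (R : realType) (n r : nat)
    (a : 'I_n.+1 -> 'rV[R]_n) (v : 'rV[R]_n) (w : 'I_n.+1 -> 'rV[R]_n) :
  (2 <= n)%N ->
  is_split a v w ->
  aligned a v w ->
  is_mos r (split_cell a v w) v (r + (n - 2) * (r.+1)./2)%N.
Proof.
move=> n2 sp al; split.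
  split; first exact: leq_addr.
  by move=> sigma; apply: smooth_supersmooth.
move=> m [_ sub]; rewrite leEnat leqNgt; apply/negP => rm.
exact: (smooth_not_supersmooth n2 sp al rm sub).
Qed.
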